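(* There is an algorithm that, given an instance $(G,k)$ of Tracking Paths in DAGs where $G$ has $n$ vertices and $m$ edges, decides whether $(G,k)$ is a YES instance in time $\mathcal{O}(2^{k^2+3k}k^2(m+n))$.
   Context: Tracking Paths in DAGs: given a directed acyclic graph $G$ with a distinguished source $s$ and destination $t$, and an integer $k$, decide whether there is $T\subseteq V(G)$ with $|T|\le k$ such that for any two distinct directed $s$-$t$ paths $P_1,P_2$ in $G$, $T\cap V(P_1)\ne T\cap V(P_2)$. *)

(* Defs.v *)
From mathcomp Require Import all_boot.

Set Implicit Arguments.
Unset Strict Implicit.
Unset Printing Implicit Defensive.

(** * Tracking paths *)

Definition arcs (n : nat) (G : rel 'I_n) : {set 'I_n * 'I_n} :=
  [set e | G e.1 e.2].

(* The MathComp predicate [cycle] holds of the empty sequence; on nonempty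
   sequences it says "closed directed walk", a loop being the case of size 1. *)
Definition acyclic (n : nat) (G : rel 'I_n) : Prop :=
  forall c : seq 'I_n, cycle G c -> c = [::].

(* A path is given by its sequence of vertices, both ends included. *)
Definition st_path (n : nat) (G : rel 'I_n) (s t : 'I_n)
    (P : seq 'I_n) : Prop :=
  exists q : seq 'I_n, [/\ P = s :: q, path G s q, last s q = t & uniq P].

Definition tracking_set (n : nat) (G : rel 'I_n) (s t : 'I_n)
    (T : {set 'I_n}) : Prop :=
  forall P1 P2 : seq 'I_n, st_path G s t P1 -> st_path G s t P2 -> P1 <> P2 ->
  T :&: [set v in P1] <> T :&: [set v in P2].

Definition tracking_paths (n : nat) (G : rel 'I_n) (s t : 'I_n)
    (k : nat) : Prop :=
  exists T : {set 'I_n}, #|T| <= k /\ tracking_set G s t T.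

(** * Word RAM *)

(* Registers and memory cells hold words of [w] bits. Arguments are register
   numbers, destination first, except for the second one of [Const], a literal,
   and the last one of the jumps, an absolute position in the program.
   Subtraction is truncated at 0, addition wraps around. *)
Inductive instr : Type :=
| Const of nat & nat
| Move of nat & nat
| Add of nat & nat & nat
| Sub of nat & nat & nat
| ReadMem of nat & nat
| WriteMem of nat & nat
| Jump of nat
| JumpEq of nat & nat & nat
| JumpLt of nat & nat & nat
| Halt of bool.

Definition program := seq instr.

Record config := Config { pc : nat; reg : nat -> nat; mem : nat -> nat }.

Definition upd (f : nat -> nat) (i v : nat) : nat -> nat :=
  fun j => if j == i then v else f j.

(* Running past the end of the program rejects. *)
Definition fetch (P : program) (x : config) : instr := nth (Halt false) P (pc x).

Definition step (w : nat) (P : program) (x : config) : config :=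
  let: Config i R M := x in
  match fetch P x with
  | Const r v => Config i.+1 (upd R r (v %% 2 ^ w)) M
  | Move r a => Config i.+1 (upd R r (R a)) M
  | Add r a b => Config i.+1 (upd R r ((R a + R b) %% 2 ^ w)) M
  | Sub r a b => Config i.+1 (upd R r (R a - R b)) M
  | ReadMem r a => Config i.+1 (upd R r (M (R a))) M
  | WriteMem a b => Config i.+1 R (upd M (R a) (R b))
  | Jump l => Config l R M
  | JumpEq a b l => Config (if R a == R b then l else i.+1) R M
  | JumpLt a b l => Config (if R a < R b then l else i.+1) R M
  | Halt _ => x
  end.

Definition start (input : seq nat) : config :=
  Config 0 (fun=> 0) (nth 0 input).

(* The cost of a run is the number of instructions executed before [Halt]. *)
Definition answers_within (w : nat) (P : program) (input : seq nat)
    (time : nat) (b : bool) : Prop :=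
  exists2 i : nat, i <= time & fetch P (iter i (step w P) (start input)) = Halt b.

(* [Halt] is a fixed point of [step], so the answer [b] is unique. *)
Definition decides_within (w : nat) (P : program) (input : seq nat)
    (time : nat) (yes : Prop) : Prop :=
  exists b : bool, answers_within w P input time b /\ (b <-> yes).

(* The digraph is presented by the list [es] of its arcs:
   n, m, s, t, k, tail and head of arc 0, tail and head of arc 1, etc. *)
Definition encode (n : nat) (es : seq ('I_n * 'I_n)) (s t : 'I_n) (k : nat) :
    seq nat :=
  [:: n; size es; val s; val t; k]
    ++ flatten [seq [:: val e.1; val e.2] | e <- es].

(* For k > 0 this is 2^(k^2+3k) k^2 (m+n). That expression is 0 for k = 0, a
   time bound which no algorithm meets; there the factor k^2 is replaced by 1. *)
Definition time_bound (n m k : nat) : nat :=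
  2 ^ (k ^ 2 + 3 * k) * maxn 1 k ^ 2 * (m + n).

(* Main.v *)
Require Import Defs.
From mathcomp Require Import all_boot.
From mathcomp Require Import zify.

Set Implicit Arguments.
Unset Strict Implicit.
Unset Printing Implicit Defensive.

(* A vertex is useful if it lies on an s-t path. A set T of useful vertices
   containing s is tracking if and only if, for every u in T, a search from u
   among the useful vertices which does not go on from the other vertices of T
   meets no vertex twice. Then the search trees have at most |T| leaves each
   and cover all useful arcs, so the sum of outdeg - 1 over the useful vertices
   is at most (k + 1) k if |T| <= k + 1. A tracker at a vertex whose only
   predecessor has no other successor can be moved to the predecessor, so it
   is enough to look for trackers among s and the other useful vertices with
   indegree at least 2 or a predecessor of outdegree at least 2. There are at
   most 3 k (k + 1) + 1 <= 2^(k + 3) of them, or there is no solution, and each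
   of the at most 2^(k^2 + 3 k) k-tuples is tested by k + 1 linear-time
   searches. *)

(** * Compiling a structured language to the word RAM *)

(** Why the searches decide: two different s-t paths with the same trackers have the same last
    tracker before the point where they merge for good, and the search from that tracker meets the
    merging point twice. Conversely, two ways through one search to the same vertex extend to two
    s-t paths with the same trackers. The vertex s lies on every s-t path and separates no two of
    them, so it may be added for free: of the k + 1 trackers, k remain to be chosen. A search tree
    has few leaves because each of them is t or a tracker other than s, and the sum of outdegree
    minus 1 over its inner vertices is the number of leaves minus 1. The time bound counts
    instructions of a concrete machine that has neither multiplication nor structured control. The
    algorithm is therefore written in a small while language whose weakest preconditions carry time
    credits, and each credit pays for at most two machine instructions. *)

Inductive cmd : Type :=
| Skip
| Lit of nat & nat
| Copy of nat & nat
| Plus of nat & nat & nat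
| Minus of nat & nat & nat
| Get of nat & nat & nat
| Put of nat & nat & nat
| Seq of cmd & cmd
| IfEq of nat & nat & cmd & cmd
| IfLt of nat & nat & cmd & cmd
| While of nat & nat & cmd.

Notation "c1 ;; c2" := (Seq c1 c2)
  (at level 59, right associativity).

Definition regs := nat -> nat.
Definition arrays := nat -> nat -> nat.

Definition upda (A : arrays) (a i v : nat) : arrays :=
  fun b => if b == a then upd (A a) i v else A b.

(** The algorithm uses the arrays 0 to 16; array 0 is the input itself. *)
Definition narr := 17.
Definition var (x : nat) := narr.+1 + x.

(* Variable [x] lives in register [var x], the base address [a * B] of array [a]
   in register [a.+1], and register 0 is scratch. *)
Fixpoint compile (p : nat) (c : cmd) : seq instr :=
  match c with
  | Skip => [::]
  | Lit x v => [:: Const (var x) v]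
  | Copy x y => [:: Move (var x) (var y)]
  | Plus x y z => [:: Add (var x) (var y) (var z)]
  | Minus x y z => [:: Defs.Sub (var x) (var y) (var z)]
  | Get x a i => [:: Add 0 a.+1 (var i); ReadMem (var x) 0]
  | Put a i x => [:: Add 0 a.+1 (var i); WriteMem 0 (var x)]
  | Seq c1 c2 =>
    let l := compile p c1 in l ++ compile (p + size l) c2
  | IfEq x y c1 c2 =>
    let l2 := compile p.+1 c2 in
    let p1 := (p.+1 + size l2).+1 in
    let l1 := compile p1 c1 in
    JumpEq (var x) (var y) p1 :: l2 ++ Jump (p1 + size l1) :: l1
  | IfLt x y c1 c2 =>
    let l2 := compile p.+1 c2 in
    let p1 := (p.+1 + size l2).+1 in
    let l1 := compile p1 c1 in
    JumpLt (var x) (var y) p1 :: l2 ++ Jump (p1 + size l1) :: l1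
  | While x y c =>
    let l := compile p.+2 c in
    [:: JumpLt (var x) (var y) p.+2, Jump (p.+2 + size l).+1
      & rcons l (Jump p)]
  end.

Fixpoint code_at (P : program) (p : nat) (l : seq instr) : Prop :=
  if l is i :: l' then nth (Halt false) P p = i /\ code_at P p.+1 l' else True.

Lemma code_at_cat P p l1 l2 :
  code_at P p (l1 ++ l2) <-> code_at P p l1 /\ code_at P (p + size l1) l2.
Proof.
elim: l1 p => [|i l1 IH] p /=; first by rewrite addn0; tauto.
by rewrite IH addSnnS; tauto.
Qed.

Lemma code_at_mid l1 l l2 : code_at (l1 ++ l ++ l2) (size l1) l.
Proof.
elim: l l1 => [|i l IH] l1 //=; split; first by rewrite nth_cat ltnn subnn.
by have := IH (rcons l1 i); rewrite size_rcons cat_rcons.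
Qed.

(** * A program logic with time credits and its soundness for compiled code *)

Section WeakestPrecondition.
Variables (w B : nat).

(* [t] counts time credits: [wp c Q t R A] says that [c] started in the state
   [(R, A)] with [t] credits ends in a state which satisfies [Q] together with
   the number of remaining credits. Sums and array indices have to be in range.
   Every test of a loop costs a credit, so loops need no variant. *)
Fixpoint wp (c : cmd) (Q : nat -> regs -> arrays -> Prop)
    (t : nat) (R : regs) (A : arrays) : Prop :=
  match c with
  | Skip => Q t R A
  | Lit x v => if t is t'.+1 then v < 2 ^ w /\ Q t' (upd R x v) A else False
  | Copy x y => if t is t'.+1 then Q t' (upd R x (R y)) A else False
  | Plus x y z => if t is t'.+1
      then R y + R z < 2 ^ w /\ Q t' (upd R x (R y + R z)) A else False
  | Minus x y z => if t is t'.+1 then Q t' (upd R x (R y - R z)) A else False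
  | Get x a i => if t is t'.+1
      then [/\ a < narr, R i < B & Q t' (upd R x (A a (R i))) A] else False
  | Put a i x => if t is t'.+1
      then [/\ a < narr, R i < B & Q t' R (upda A a (R i) (R x))] else False
  | Seq c1 c2 => wp c1 (wp c2 Q) t R A
  | IfEq x y c1 c2 => if t is t'.+1
      then if R x == R y then wp c1 Q t' R A else wp c2 Q t' R A else False
  | IfLt x y c1 c2 => if t is t'.+1
      then if R x < R y then wp c1 Q t' R A else wp c2 Q t' R A else False
  | While x y c => exists2 I : nat -> regs -> arrays -> Prop, I t R A &
      forall t R A, I t R A -> if t is t'.+1
        then if R x < R y then wp c I t' R A else Q t' R A else False
  end.

Lemma wp_mono c (Q1 Q2 : nat -> regs -> arrays -> Prop) t R A :
    (forall t R A, Q1 t R A -> Q2 t R A) -> wp c Q1 t R A -> wp c Q2 t R A.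
Proof.
elim: c Q1 Q2 t R A => [|x v|x y|x y z|x y z|x a j|a j x|c1 IH1 c2 IH2
  |x y c1 IH1 c2 IH2|x y c1 IH1 c2 IH2|x y c IH] Q1 Q2 t R A HQ /=;
  try (by case: t => // t; case=> *; split; auto); auto;
  try (by case: t => //; auto).
- by apply: IH1 => *; apply: IH2 HQ _.
- by case: t => // t; case: ifP => _; [apply: IH1 | apply: IH2].
- by case: t => // t; case: ifP => _; [apply: IH1 | apply: IH2].
- case=> I HI HW; exists I => // t' R' A' /HW; case: t' => // t'.
  by case: ifP => // _; apply: HQ.
Qed.

Lemma wp_seq c1 c2 Q t R A : wp c1 (wp c2 Q) t R A -> wp (c1 ;; c2) Q t R A.
Proof. by []. Qed.

(** Register 0 is left unconstrained, so that address computations preserve the relation. *)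
Definition simulates (R : regs) (A : arrays) (r M : nat -> nat) : Prop :=
  [/\ forall x, r (var x) = R x,
      forall a, a < narr -> r a.+1 = a * B &
      forall a i, a < narr -> i < B -> M (a * B + i) = A a i].

Hypothesis memory_fits : narr * B <= 2 ^ w.

Lemma block_lt a i : a < narr -> i < B -> a * B + i < 2 ^ w.
Proof. by move=> aK iB; apply: leq_trans memory_fits; rewrite /narr in aK *; nia. Qed.

Lemma block_inj a b i j : i < B -> j < B ->
  (a * B + i == b * B + j) = (a == b) && (i == j).
Proof.
move=> iB jB; apply/idP/idP; last by case/andP=> /eqP-> /eqP->.
move/eqP=> E; have B0 : 0 < B by apply: leq_ltn_trans iB.
have := congr1 (divn^~ B) E; have := congr1 (modn^~ B) E.
by rewrite !modnMDl !divnMDl // !modn_small // !divn_small // !addn0 => -> ->;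
   rewrite !eqxx.
Qed.

Lemma simulates_var x v R A r M :
  simulates R A r M -> simulates (upd R x v) A (upd r (var x) v) M.
Proof.
case=> Hr Hb HM; split=> //.
- by move=> y; rewrite /upd eqn_add2l Hr.
- move=> a aK; rewrite /upd ifF ?Hb //; apply/eqP; rewrite /var /narr in aK *; lia.
Qed.

Lemma simulates_scratch v R A r M :
  simulates R A r M -> simulates R A (upd r 0 v) M.
Proof. by case=> Hr Hb HM; split. Qed.

Lemma simulates_put a i v R A r M : a < narr -> i < B ->
  simulates R A r M -> simulates R (upda A a i v) r (upd M (a * B + i) v).
Proof.
move=> aK iB [Hr Hb HM]; split=> // b j bK jB.
rewrite /upda /upd block_inj // [b == a]eq_sym; case: eqVneq => [->|_] /=;
  last by rewrite HM.
by case: eqP => // _; rewrite HM.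
Qed.

(** A credit pays for two instructions: an array access computes an address first, and a round of a
    loop has a test and a jump. *)
Lemma wp_sound c Q t R A P p r M :
  wp c Q t R A -> code_at P p (compile p c) -> simulates R A r M ->
  exists i t' R' A' r' M',
    [/\ iter i (step w P) (Config p r M) = Config (p + size (compile p c)) r' M',
        i + 2 * t' <= 2 * t, simulates R' A' r' M' & Q t' R' A'].
Proof.
have iter1 i x y : step w P x = y -> iter i.+1 (step w P) x = iter i (step w P) y.
  by move=> <-; rewrite iterSr.
elim: c Q t R A p r M => [|x v|x y|x y z|x y z|x a j|a j x|c1 IH1 c2 IH2
  |x y c1 IH1 c2 IH2|x y c1 IH1 c2 IH2|x y c IH] Q t R A p r M /=.
- by move=> HQ _ Hs; exists 0, t, R, A, r, M; rewrite addn0.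
- case: t => // t [lv HQ] [Hp _] Hs.
  exists 1, t, (upd R x v), A, (upd r (var x) v), M; split=> //.
  + by rewrite /= /fetch /= Hp modn_small // addn1.
  + by lia.
  + exact: simulates_var.
- case: t => // t HQ [Hp _] Hs.
  exists 1, t, (upd R x (R y)), A, (upd r (var x) (R y)), M; split=> //.
  + by rewrite /= /fetch /= Hp addn1; case: Hs => ->.
  + by lia.
  + exact: simulates_var.
- case: t => // t [lv HQ] [Hp _] Hs.
  exists 1, t, (upd R x (R y + R z)), A, (upd r (var x) (R y + R z)), M.
  split=> //.
  + by rewrite /= /fetch /= Hp addn1; case: Hs => Hv _ _; rewrite !Hv modn_small.
  + by lia.
  + exact: simulates_var.
- case: t => // t HQ [Hp _] Hs.
  exists 1, t, (upd R x (R y - R z)), A, (upd r (var x) (R y - R z)), M.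
  split=> //.
  + by rewrite /= /fetch /= Hp addn1; case: Hs => Hv _ _; rewrite !Hv.
  + by lia.
  + exact: simulates_var.
- case: t => // t [aK jB HQ] [Hp [Hp' _]] Hs.
  exists 2, t, (upd R x (A a (R j))), A,
    (upd (upd r 0 (a * B + R j)) (var x) (A a (R j))), M.
  split=> //.
  + case: Hs => Hv Hb HM; rewrite /= /fetch /= Hp /= /fetch /= Hp' Hv Hb // modn_small ?block_lt //.
    by rewrite {3}/upd eqxx HM // addn2.
  + by lia.
  + exact/simulates_var/simulates_scratch.
- case: t => // t [aK jB HQ] [Hp [Hp' _]] Hs.
  exists 2, t, R, (upda A a (R j) (R x)), (upd r 0 (a * B + R j)),
    (upd M (a * B + R j) (R x)).
  split=> //.
  + case: Hs => Hv Hb HM; rewrite /= /fetch /= Hp /= /fetch /= Hp' Hv Hb // modn_small ?block_lt //.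
    by rewrite addn2 -[upd r _ _ (var x)]/(r (var x)) Hv.
  + by lia.
  + exact/simulates_put/simulates_scratch.
- move=> H1 /code_at_cat[Hc1 Hc2] Hs.
  have [i1 [t1 [R1 [A1 [r1 [M1 [E1 l1 Hs1 H2]]]]]]] := IH1 _ _ _ _ _ _ _ H1 Hc1 Hs.
  have [i2 [t2 [R2 [A2 [r2 [M2 [E2 l2 Hs2 H3]]]]]]] := IH2 _ _ _ _ _ _ _ H2 Hc2 Hs1.
  exists (i2 + i1), t2, R2, A2, r2, M2; split=> //; last by lia.
  by rewrite iterD E1 E2 size_cat addnA.
- case: t => // t H [Hp /code_at_cat[Hc2 /= [Hj Hc1]]] Hs.
  set l2 := compile p.+1 c2 in Hp Hc2 Hj Hc1 *.
  set p1 := (p.+1 + size l2).+1 in Hp Hj Hc1 *.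
  set l1 := compile p1 c1 in Hj Hc1 *.
  have Ep : p + (size (l2 ++ Jump (p1 + size l1) :: l1)).+1 = p1 + size l1.
    by rewrite size_cat /= /p1; lia.
  case: ifP H => [Exy H|Exy H].
  + have [i1 [t1 [R1 [A1 [r1 [M1 [E1 le1 Hs1 H2]]]]]]] := IH1 _ _ _ _ _ _ _ H Hc1 Hs.
    exists i1.+1, t1, R1, A1, r1, M1; rewrite Ep; split=> //; last by lia.
    by rewrite (iter1 _ _ (Config p1 r M)) ?E1 //= /fetch /= Hp;
       case: Hs => Hv _ _; rewrite !Hv Exy.
  + have [i2 [t2 [R2 [A2 [r2 [M2 [E2 le2 Hs2 H3]]]]]]] := IH2 _ _ _ _ _ _ _ H Hc2 Hs.
    exists i2.+2, t2, R2, A2, r2, M2; rewrite Ep; split=> //; last by lia.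
    rewrite iterS (iter1 _ _ (Config p.+1 r M)) ?E2 //= /fetch /= ?Hj //.
    by rewrite Hp; case: Hs => Hv _ _; rewrite !Hv Exy.
- case: t => // t H [Hp /code_at_cat[Hc2 /= [Hj Hc1]]] Hs.
  set l2 := compile p.+1 c2 in Hp Hc2 Hj Hc1 *.
  set p1 := (p.+1 + size l2).+1 in Hp Hj Hc1 *.
  set l1 := compile p1 c1 in Hj Hc1 *.
  have Ep : p + (size (l2 ++ Jump (p1 + size l1) :: l1)).+1 = p1 + size l1.
    by rewrite size_cat /= /p1; lia.
  case: ifP H => [Exy H|Exy H].
  + have [i1 [t1 [R1 [A1 [r1 [M1 [E1 le1 Hs1 H2]]]]]]] := IH1 _ _ _ _ _ _ _ H Hc1 Hs.
    exists i1.+1, t1, R1, A1, r1, M1; rewrite Ep; split=> //; last by lia.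
    by rewrite (iter1 _ _ (Config p1 r M)) ?E1 //= /fetch /= Hp;
       case: Hs => Hv _ _; rewrite !Hv Exy.
  + have [i2 [t2 [R2 [A2 [r2 [M2 [E2 le2 Hs2 H3]]]]]]] := IH2 _ _ _ _ _ _ _ H Hc2 Hs.
    exists i2.+2, t2, R2, A2, r2, M2; rewrite Ep; split=> //; last by lia.
    rewrite iterS (iter1 _ _ (Config p.+1 r M)) ?E2 //= /fetch /= ?Hj //.
    by rewrite Hp; case: Hs => Hv _ _; rewrite !Hv Exy.
- case=> I HI HW [Hp [Hj]]; rewrite -cats1 => /code_at_cat[Hc /= [Hb _]].
  rewrite size_cat /= addn1.
  set l := compile p.+2 c in Hj Hc Hb *.
  (* Every test of the loop uses up a credit, so the credits themselves serve as the variant. *)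
  elim/ltn_ind: t R A r M HI => t IHt R A r M HI Hs.
  move: (HW _ _ _ HI); case: t IHt {HI} => // t IHt; case: ifP => Exy H.
  + have [i1 [t1 [R1 [A1 [r1 [M1 [E1 le1 Hs1 H2]]]]]]] := IH _ _ _ _ _ _ _ H Hc Hs.
    have [|i2 [t2 [R2 [A2 [r2 [M2 [E2 le2 Hs2 H3]]]]]]] := IHt _ _ _ _ _ _ H2 Hs1.
      by lia.
    exists (i2 + i1.+2), t2, R2, A2, r2, M2; split=> //; last by lia.
    rewrite iterD iterS (iter1 _ _ (Config p.+2 r M)) ?E1 /=.
      by rewrite /fetch /= Hb E2.
    by rewrite /fetch /= Hp; case: Hs => Hv _ _; rewrite !Hv Exy.
  + exists 2, t, R, A, r, M; split=> //; last by lia.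
    rewrite (iter1 _ _ (Config p.+1 r M)) /=; first by rewrite /fetch /= Hj; congr Config; lia.
    by rewrite /fetch /= Hp; case: Hs => Hv _ _; rewrite !Hv Exy.
Qed.

End WeakestPrecondition.

(* Register 0 receives the size 2 (n + m + k) + 8 of a block, where n, m, k are
   the cells 0, 1, 4 of the input, then the base registers are filled. *)
Definition prelude : program :=
  [:: ReadMem 1 0; Const 0 1; ReadMem 2 0; Add 1 1 2; Const 0 4; ReadMem 2 0;
      Add 1 1 2; Add 1 1 1; Const 0 8; Add 0 0 1; Const 1 0]
  ++ [seq Add a.+1 a 0 | a <- iota 1 narr.-1].

Definition ram (c : cmd) (ans : nat) : program :=
  let p := size prelude in
  let l := compile p c in
  prelude ++ l ++
  [:: Const 0 1; JumpEq (var ans) 0 (p + size l + 3); Halt false; Halt true].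

(** One size for all arrays: it has room for the 5 + 2 m cells of the input and for indices that are
    vertices, arcs numbered from 1, or positions in a (k + 1)-tuple. *)
Definition block (input : seq nat) : nat :=
  2 * (nth 0 input 0 + nth 0 input 1 + nth 0 input 4) + 8.

Definition input_array (input : seq nat) : arrays :=
  fun a i => if a == 0 then nth 0 input i else 0.

Lemma bases_correct w B P r M p j : j < narr -> narr * B <= 2 ^ w ->
  code_at P p [seq Add a.+1 a 0 | a <- iota 1 j] ->
  0 < B -> r 0 = B -> r 1 = 0 -> (forall x, narr < x -> r x = 0) ->
  exists r', [/\ iter j (step w P) (Config p r M) = Config (p + j) r' M,
    r' 0 = B, forall a, a <= j -> r' a.+1 = a * B &
    forall x, narr < x -> r' x = 0].
Proof.
move=> jn wB Hc B0 r0 r1 rh; elim: j jn Hc => [|j IH] jn.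
  by exists r; split=> //; [rewrite addn0 | case].
rewrite -{1}[j.+1]addn1 iotaD map_cat => /code_at_cat[/IH[|r' [E E0 Eb Eh]]]; first by lia.
rewrite /= size_map size_iota add1n => -[Hp _].
exists (upd r' j.+2 (j.+1 * B)); split=> //.
- rewrite /= E /= /fetch /= Hp Eb // E0 -mulSnr modn_small ?addnS //.
  by apply: leq_trans wB; rewrite ltn_mul2r jn B0.

- move=> a; rewrite leq_eqVlt => /orP[/eqP->|]; first by rewrite /upd eqxx.
  by rewrite ltnS => aj; rewrite /upd ifF ?Eb //; apply/eqP; lia.
- by move=> x xn; rewrite /upd ifF ?Eh //; apply/eqP; lia.
Qed.

(** The additive 30 covers 11 instructions for the block size, 16 for the bases and 2 to inspect the
    answer. *)
Lemma ram_correct w input c ans t b :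
    size input <= block input -> narr * block input <= 2 ^ w ->
    wp w (block input) c (fun _ R _ => R ans = nat_of_bool b) t
      (fun=> 0) (input_array input) ->
  answers_within w (ram c ans) input (2 * t + 30) b.
Proof.
set B := block input => sB wB Hwp; set P := ram c ans.
have [c1 [c2 c3]] : code_at P 0 prelude /\ code_at P (size prelude)
    (compile (size prelude) c) /\
    code_at P (size prelude + size (compile (size prelude) c))
    [:: Const 0 1; JumpEq (var ans) 0 (size prelude + size (compile (size prelude) c) + 3);
      Halt false; Halt true].
  split; first by apply: (@code_at_mid [::] prelude (_ ++ _)).
  split; first by apply: (@code_at_mid prelude (compile _ c)).
  rewrite -size_cat /P /ram catA -[X in _ ++ X]cats0.
  exact: code_at_mid.
have w8 : 8 * 17 <= 2 ^ w.
  by apply: leq_trans wB; rewrite /B /block /narr; lia.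
pose M := nth 0 input.
have [r1 [E1 E10 E11 E1h]] : exists r1,
  [/\ iter 11 (step w P) (Config 0 (fun=> 0) M) = Config 11 r1 M,
    r1 0 = B, r1 1 = 0 & forall x, narr < x -> r1 x = 0].
  have [v Ev] : exists v, v = M 0 + M 1 + M 4 by eexists.
  have Bv : B = 8 + (v + v) by rewrite /B /block -/(M 0) -/(M 1) -/(M 4) -Ev; lia.
  have lev : 17 * (8 + (v + v)) <= 2 ^ w by rewrite -Bv.
  eexists; split.
  - by rewrite /step /fetch /=; reflexivity.
  - have small x : x <= 8 + (v + v) -> x %% 2 ^ w = x by move=> ?; rewrite modn_small //; lia.
    rewrite /upd /= Bv (small 1) ?(small 4) ?(small 8) ?(small (M 0 + M 1)) -?Ev
      ?(small v) ?(small (v + v)) ?small //;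
      lia.
  - by rewrite /upd /= mod0n.
  - by move=> x xn; rewrite /narr in xn; rewrite /upd !ifF //; apply/eqP; lia.
have [r2 [E2 _ Eb Eh]] : exists r', [/\ iter 16 (step w P) (Config 11 r1 M) = Config 27 r' M,
    r' 0 = B, forall a, a <= 16 -> r' a.+1 = a * B & forall x, narr < x -> r' x = 0].
  by apply: bases_correct => //; rewrite /B /block addnS.
have Hs : simulates B (fun=> 0) (input_array input) r2 M.
  split.
  - by move=> x; apply: Eh; rewrite /var; lia.
  - by move=> a; rewrite ltnS; apply: Eb.
  (* The input fits into block 0, so all other blocks lie beyond it and read 0. *)
  - case=> [|a] i aK iB; first by [].
    apply: nth_default; apply: leq_trans sB _.
    by rewrite mulSn -addnA leq_addr.
have [i [t' [R' [A' [r' [M' [E3 lt Hs' HQ]]]]]]] := wp_sound wB Hwp c2 Hs.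
have [Hv _ _] := Hs'; case: c3 => c31 [c32 [c33 [c34 _]]].
exists (2 + (i + (16 + 11))); first by lia.
set p := size prelude in c31 c32 c33 c34 E3.
rewrite /start -/M !iterD E1 E2 -[27]/p E3. clearbody P p.
rewrite /= /fetch /= c31 /= /fetch /= c32 modn_small; last by lia.
rewrite /upd /= Hv HQ.
by case: b {Hwp HQ} => //=; rewrite addn3.
Qed.

(** * Tracking sets of acyclic digraphs *)

Section Search.
Variables (n : nat) (g : rel 'I_n) (al bl : pred 'I_n) (root : 'I_n).

(* The vertices [al] may be entered; those in [bl] are not left again. *)
Definition explored : pred 'I_n :=
  connect [rel a b | [&& g a b, al b & ~~ bl b]] root.

(** A vertex of [bl] can be met without being explored; the root is explored even if it belongs to
    [bl]. *)
Definition met (x : 'I_n) : bool :=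
  (x == root) || [exists a, [&& explored a, g a x & al x]].

(** Arcs are simple, so a vertex other than the root is met twice only from two different explored
    vertices. The root counts as met at the start. *)
Definition met_twice : bool :=
  [exists a, [&& explored a, g a root & al root]] ||
  [exists a, exists b, exists x,
     [&& a != b, explored a, explored b, g a x, g b x & al x]].

End Search.

Section Dag.
Variables (n : nat) (G : rel 'I_n) (s t : 'I_n).

(** Phrased as the outcome of a search, so that the correctness of the search program applies as it
    is; [reachedE] recovers reachability. *)
Definition reached : pred 'I_n := met G xpredT xpred0 s.

(* [t] is useful even if it is not reached from [s]. *)
Definition useful : pred 'I_n := met [rel a b | G b a] reached xpred0 t.

Definition good (T : {set 'I_n}) : bool :=
  [forall u in T, ~~ met_twice G useful (mem T) u].

Definition useful_arc : rel 'I_n := [rel a b | [&& G a b, useful a & useful b]].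
Definition outdeg (a : 'I_n) : nat := #|[set b | useful_arc a b]|.
Definition indeg (b : 'I_n) : nat := #|[set a | useful_arc a b]|.

(* A tracker at a vertex whose only predecessor has no other successor can be
   moved to that predecessor. *)
Definition candidates : {set 'I_n} :=
  s |: [set b | [exists a, useful_arc a b && ((1 < outdeg a) || (1 < indeg b))]].

Definition max_candidates (k : nat) : nat := 3 * (k * k.+1) + 1.

Hypothesis acG : acyclic G.

Lemma acyclic_arc a b : connect G a b -> ~~ G b a.
Proof.
case/connectP=> p pp ->; apply/negP => ba.
by have := acG (c := a :: p); rewrite /= rcons_path pp ba => /(_ isT).
Qed.

Lemma acyclic_anti a b : connect G a b -> connect G b a -> a = b.
Proof.
case/connectP=> p; elim/last_ind: p b => [|p c IH] b //=.
rewrite rcons_path last_rcons => /andP[pp lc] -> ca.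
have al : connect G a (last a p) by apply/connectP; exists p.
by have := acyclic_arc (connect_trans ca al); rewrite lc.
Qed.

Lemma acyclic_uniq x p : path G x p -> uniq (x :: p).
Proof.
elim: p x => //= y p IH x /andP[xy pp]; have /= -> := IH _ pp; rewrite andbT.
apply/negP => /(path_connect pp) yx.
by have := acyclic_arc yx; rewrite xy.
Qed.

Lemma sorted_st_path P : st_path G s t P -> sorted G P.
Proof. by case=> q [->]. Qed.

Lemma sorted_connect c u d v : sorted G (c ++ u :: d) -> v \in rcons c u -> connect G v u.
Proof.
elim: c => [|y c IH] /=; first by rewrite inE => _ /eqP->.
move=> pp; rewrite inE => /predU1P[->|vc]; last first.
  by apply: IH vc; move: pp => /path_sorted.
by apply: (path_connect pp); rewrite !inE mem_cat inE eqxx !orbT.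
Qed.

Lemma reachedE x : reached x = connect G s x.
Proof.
rewrite /reached /met /explored.
rewrite (eq_existsb (P2 := fun a => connect G s a && G a x)); last first.
  by move=> a; rewrite /= andbT; congr andb; apply: eq_connect => u v /=; rewrite andbT.
apply/orP/idP => [[/eqP->|/existsP[a /andP[sa ax]]]|/connectP[p]].
- exact: connect0.
- exact: connect_trans sa (connect1 ax).
- case/lastP: p => [_ ->|p y]; first by left.
  rewrite rcons_path last_rcons => /andP[pp ly] ->; right; apply/existsP.
  by exists (last s p); rewrite ly andbT; apply/connectP; exists p.
Qed.

Lemma usefulW x : useful x -> x = t \/ connect G s x /\ connect G x t.
Proof.
rewrite /useful /met => /orP[/eqP|/existsP[a /and3P[ta /= xa]]]; first by left.
rewrite reachedE => sx; right; split=> //.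
apply: connect_trans (connect1 xa) _; case/connectP: ta => p.
elim: p (t) => [|y p IH] r /=; first by move=> _ ->.
case/andP=> /andP[yr _] /IH H /H; move/connect_trans; apply; exact: connect1.
Qed.

Lemma useful_target : useful t. Proof. by rewrite /useful /met eqxx. Qed.

(** * Good sets and tracking sets when t can be reached from s *)

Section Connected.
Hypothesis st : connect G s t.

Lemma usefulE x : useful x = connect G s x && connect G x t.
Proof.
apply/idP/andP => [/usefulW[->|]|[sx]] //.
case/connectP=> p; elim: p x sx => [|y p IH] x sx /=; first by move=> _ <-; apply: useful_target.
case/andP=> xy pp lp; have sy := connect_trans sx (connect1 xy).
have := IH y sy pp lp; rewrite /useful /met => H; apply/orP; right.
apply/existsP; exists y; rewrite reachedE sx /= xy /= andbT.
case/orP: H => [/eqP->|/existsP[z /and3P[tz zy ry]]]; first exact: connect0.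
by apply: connect_trans tz (connect1 _); apply/and3P; split.
Qed.

Lemma useful_st_path P v : st_path G s t P -> v \in P -> useful v.
Proof.
case=> q [-> pq lq _] vq; rewrite usefulE (path_connect pq) //=.
case/splitPl: vq pq lq => p1 p2 <-; rewrite cat_path last_cat => /andP[_ p2p] l2.
by apply/connectP; exists p2.
Qed.

Lemma st_pathI q : path G s q -> last s q = t -> st_path G s t (s :: q).
Proof. by move=> pq lq; exists q; split=> //; apply: acyclic_uniq. Qed.

Lemma exploredP (T : {set 'I_n}) u a : explored G useful (mem T) u a ->
  exists p, [/\ path G u p, last u p = a & {in p, forall v, v \notin T}].
Proof.
case/connectP=> p pp ->; exists p; split=> //.
  by apply: sub_path pp => x y /and3P[].
move=> v; elim: p u pp => //= y p IH u /andP[/and3P[_ _ yT] pp].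
by rewrite inE => /predU1P[->|] //; apply: IH pp.
Qed.

Lemma explored_connect (T : {set 'I_n}) u a :
  explored G useful (mem T) u a -> connect G u a.
Proof. by case/exploredP=> p [pp <- _]; apply/connectP; exists p. Qed.

Lemma connect_explored (T : {set 'I_n}) u p : path G u p ->
  {in p, forall v, useful v && (v \notin T)} ->
  explored G useful (mem T) u (last u p).
Proof.
move=> pp H; apply/connectP; exists p => //.
elim: p u pp H => //= y p IH u /andP[uy pp] H; rewrite uy /= H ?inE ?eqxx //=.
by apply: IH => // v vp; apply: H; rewrite inE vp orbT.
Qed.

(** If the search from u meets x twice, the two ways from u to x have no tracker strictly in
    between. A common beginning from s to u and a common end from x to t complete them to two s-t
    paths with equal trackers. Acyclicity excludes that u is met again. *)
Lemma tracking_good (T : {set 'I_n}) : {subset T <= useful} ->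
  tracking_set G s t T -> good T.
Proof.
move=> TU trT; apply/forall_inP => u uT; apply/negP => /orP[/existsP[a]|].
  by case/and3P=> /explored_connect/acyclic_arc/negbTE->.
case/existsP=> a /existsP[b /existsP[x]].
case/and5P=> ab /exploredP[pa [pap la nTa]] /exploredP[pb [pbp lb nTb]] ax.
case/andP=> bx; rewrite usefulE => /andP[_ /connectP[q qp lq]].
have /connectP[p0 p0p lp0] : connect G s u.
  by have := TU _ uT; rewrite -topredE /= usefulE => /andP[].
have P p c : path G u p -> last u p = c -> G c x ->
    st_path G s t (s :: p0 ++ p ++ x :: q).
  move=> pp lp cx; apply: st_pathI.
    by rewrite !cat_path /= -lp0 pp p0p lp cx.
  by rewrite !last_cat /= -lq.
apply: (trT _ _ (P _ _ pap la ax) (P _ _ pbp lb bx)).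
  (* Cancelling the common beginning and end identifies [pa] and [pb], whose last vertices [a] and
     [b] differ. *)
  case=> /(congr1 (drop (size p0))); rewrite !drop_size_cat // => E.
  have /eqP := E; rewrite eqseq_cat; last first.
    by have /(congr1 size)/eqP := E; rewrite !size_cat eqn_add2r => /eqP.
  by case/andP=> /eqP E' _; case/eqP: ab; rewrite -la -lb E'.
apply/setP => v; rewrite !inE !mem_cat; case: (boolP (v \in T)) => //= vT.
have -> : v \in pa = false by apply: contraTF vT => /nTa.
by have -> : v \in pb = false by apply: contraTF vT => /nTb.
Qed.

(** The longest common suffix exhausts one list or is preceded by different elements. The comparison
    runs from the end because a vertex met twice is a place where paths merge. *)
Lemma diverge (T : eqType) (l1 l2 : seq T) : l1 <> l2 ->
  [\/ exists2 p, p != [::] & l1 = p ++ l2,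
      exists2 p, p != [::] & l2 = p ++ l1 |
      exists p1 a p2 b q, [/\ l1 = rcons p1 a ++ q, l2 = rcons p2 b ++ q & a != b]].
Proof.
elim/last_ind: l1 l2 => [|l1 a IH] l2.
  by move=> /eqP; rewrite eq_sym => ne; constructor 2; exists l2; rewrite ?cats0.
case/lastP: l2 => [|l2 b].
  by move=> /eqP ne; constructor 1; exists (rcons l1 a); rewrite ?cats0.
case: (eqVneq a b) => [<-|ab] ne; last first.
  by constructor 3; exists l1, a, l2, b, [::]; rewrite !cats0.
have {}ne : l1 <> l2 by move=> E; apply: ne; rewrite E.
case: (IH l2 ne) => [[p p0 ->]|[p p0 ->]|[p1 [c [p2 [d [q [-> -> cd]]]]]]].
- by constructor 1; exists p; rewrite ?rcons_cat.
- by constructor 2; exists p; rewrite ?rcons_cat.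
- by constructor 3; exists p1, c, p2, d, (rcons q a); rewrite !rcons_cat.
Qed.

Lemma split_last_in (T : eqType) (A : pred T) (l : seq T) : has A l ->
  exists c u d, [/\ l = c ++ u :: d, A u & {in d, forall v, ~~ A v}].
Proof.
elim/last_ind: l => // l x IH; rewrite has_rcons; case Ax: (A x) => /=.
  by exists l, x, [::]; rewrite -cats1.
case/IH=> c [u [d [-> Au nd]]]; exists c, u, (rcons d x); split=> //.
  by rewrite rcons_cat.
by move=> v; rewrite mem_rcons inE => /predU1P[->|/nd]; rewrite ?Ax.
Qed.

(* Two paths with the same trackers which part before a common suffix x :: q
   have the same last tracker u before x, as trackers are met in the same order;
   the search from u meets x twice. *)
Lemma good_tracking (T : {set 'I_n}) : s \in T -> good T -> tracking_set G s t T.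
Proof.
move=> sT /forall_inP gT P1 P2 st1 st2 ne ET.
(* Both paths start at s, which would occur twice in P. *)
have nsuf P Q p : st_path G s t P -> st_path G s t Q -> p != [::] -> P <> p ++ Q.
  case=> q [-> _ _ u1] [q' [-> _ _ _]]; case: p => // y p _ [_ E].
  by move: u1; rewrite E /= mem_cat inE eqxx orbT.
case: (diverge ne) => [[p p0 E]|[p p0 E]|[p1 [a [p2 [b [q [E1 E2 ab]]]]]]].
- exact: nsuf E.
- exact: nsuf E.
have lastP_t P d : st_path G s t P -> last d P = t by case=> r [-> /= _ -> _].
case: q E1 E2 => [|x q] E1 E2.
  case/eqP: ab; have := lastP_t _ s st1; have := lastP_t _ s st2.
  by rewrite E1 E2 !cats0 !last_rcons => -> ->.
have split P p c : st_path G s t P -> P = rcons p c ++ x :: q ->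
    exists l u d, [/\ P = l ++ u :: d ++ x :: q, last u d = c, u \in T,
      {in d, forall v, v \notin T} & explored G useful (mem T) u c].
  move=> stP EP; have hT : has (mem T) (rcons p c).
    apply/hasP; exists s => //.
    by case: stP => r [Er _ _ _]; move: EP; rewrite Er; case: p => [|z p] [<- _]; rewrite inE eqxx.
  have [l [u [d [El uT nd]]]] := split_last_in hT.
  have lc : last u d = c by have := congr1 (last c) El; rewrite last_rcons last_cat.
  exists l, u, d; split=> //; first by rewrite EP El -catA.
  rewrite -lc; apply: connect_explored.
    have := sorted_st_path stP; rewrite EP El -catA => /cat_sorted2[_] /=.
    by rewrite cat_path => /andP[].
  move=> v vd; rewrite nd // andbT; apply: (useful_st_path stP).
  by rewrite EP El !(mem_cat, inE) vd !orbT.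
have [l1 [u1 [d1 [F1 c1 uT1 n1 x1]]]] := split _ _ _ st1 E1.
have [l2 [u2 [d2 [F2 c2 uT2 n2 x2]]]] := split _ _ _ st2 E2.
(* The tracker u of P lies on Q too; it is not in [d'], which has no trackers, nor in [x :: q], as P
   repeats no vertex. So it is [u'] or precedes it on Q. *)
have before P Q l u d l' u' d' : st_path G s t P -> st_path G s t Q ->
    T :&: [set v in P] = T :&: [set v in Q] -> u \in T -> {in d', forall v, v \notin T} ->
    P = l ++ u :: d ++ x :: q -> Q = l' ++ u' :: d' ++ x :: q -> connect G u u'.
  move=> stP stQ ETT uT nd' FP FQ.
  have /setP/(_ u) := ETT; rewrite !inE uT /= FP FQ mem_cat inE eqxx orbT.
  move/esym; rewrite mem_cat inE mem_cat => uQ.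
  apply: (@sorted_connect l' u' (d' ++ x :: q)); first by rewrite -FQ; apply: sorted_st_path.
  have nq : u \notin x :: q.
    case: stP => r [_ _ _]; rewrite FP cat_uniq => /and3P[_ _ /=].
    by rewrite mem_cat negb_or => /andP[/andP[_ ->]].
  rewrite mem_rcons inE; case/or4P: uQ => [->|->|ud|uq] //; rewrite ?orbT //.
    by have := nd' _ ud; rewrite uT.
  by rewrite uq in nq.
have Eu : u1 = u2.
  apply: acyclic_anti; first exact: before F1 F2.
  exact: before (esym ET) uT2 n1 F2 F1.
case/negP: (gT _ uT1); apply/orP; right.
apply/existsP; exists a; apply/existsP; exists b; apply/existsP; exists x.
rewrite ab x1 Eu x2 /=.
have arc P p c : st_path G s t P -> P = rcons p c ++ x :: q -> G c x.
  move=> /sorted_st_path + EP; rewrite EP cat_rcons => /cat_sorted2[_] /=.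
  by case/andP.
rewrite (arc _ _ _ st1 E1) (arc _ _ _ st2 E2) /=; apply: (useful_st_path st1).
by rewrite E1 mem_cat inE eqxx orbT.
Qed.

(** * Moving trackers to candidates *)

Lemma pred_useful v : useful v -> v != s -> exists a, useful_arc a v.
Proof.
move=> uv vs; have := uv; rewrite usefulE => /andP[/connectP[p] + + vt].
case/lastP: p => [_ E|p x]; first by rewrite E eqxx in vs.
rewrite rcons_path last_rcons => /andP[pp lx] E; rewrite {}E in uv vt *.
exists (last s p); rewrite /useful_arc /= lx uv andbT /= usefulE.
apply/andP; split; first by apply/connectP; exists p.
exact: connect_trans (connect1 lx) vt.
Qed.

Lemma succ_useful v : useful v -> v != t -> exists a, useful_arc v a.
Proof.
move=> uv vt; have := uv; rewrite usefulE => /andP[sv /connectP[[|x p]]] /=.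
  by move=> _ E; rewrite E eqxx in vt.
case/andP=> vx pp E; exists x; rewrite /useful_arc /= vx uv usefulE /=.
rewrite (connect_trans sv (connect1 vx)) /=.
by apply/connectP; exists p.
Qed.

(** A vertex which is not a candidate lies on the same s-t paths as its only useful predecessor.
    Going back to predecessors ends at a candidate, since the number of ancestors decreases: v
    reaches itself but not its predecessor. *)
Lemma candidate_eqP v : useful v ->
  exists2 x, x \in candidates & forall P, st_path G s t P -> (v \in P) = (x \in P).
Proof.
have [m] := ubnP #|[set y | connect G y v]|; elim: m v => // m IH v lev uv.
case: (boolP (v \in candidates)) => [cv|]; first by exists v.
rewrite !inE negb_or => /andP[vs /existsPn nc].
have [a av] := pred_useful uv vs.
have [oa iv] : outdeg a <= 1 /\ indeg v <= 1.
  by have := nc a; rewrite av /= negb_or -!leqNgt => /andP.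
have [Gav ua _] := and3P av.
have [|x cx Hx] := IH a _ ua.
  rewrite -ltnS; apply: leq_trans lev; rewrite ltnS; apply: proper_card.
  apply/properP; split.
    by apply/subsetP => y; rewrite !inE => ya; apply: connect_trans ya (connect1 Gav).
  exists v; rewrite inE ?connect0 //; apply/negP => /acyclic_arc.
  by rewrite Gav.
exists x => // P stP; rewrite -Hx //; apply/idP/idP => [vP|aP].
  have := sorted_st_path stP; case: (stP) => q [EP _ _ _].
  move: EP; case/splitPr: vP (stP) => p1 p2 stP'; case/lastP: p1 stP' => [|p1 b] stP'.
    by case=> E; rewrite E eqxx in vs.
  move=> _; rewrite cat_rcons => /cat_sorted2[_ /= /andP[bv _]].
  have ub : useful b by apply: (useful_st_path stP'); rewrite mem_cat mem_rcons inE eqxx.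
  have -> : a = b.
    by apply: (card_le1_eqP iv); rewrite inE // /useful_arc /= bv ub uv.
  by rewrite mem_cat inE eqxx orbT.
(* A path through [a] does not end there, for [a = t] would close a cycle through v; it leaves [a]
   by its only useful arc. *)
have := sorted_st_path stP; case: (stP) => q [EP _ lq _].
move: (congr1 (last s) EP) => /=; rewrite lq.
case/splitPr: aP (stP) => p1 [|b p2] stP'.
  rewrite last_cat /= => E; move: Gav uv; rewrite E usefulE => tv /andP[_ /acyclic_arc].
  by rewrite tv.
move=> _ /cat_sorted2[_ /= /andP[ab _]].
have ub : useful b by apply: (useful_st_path stP'); rewrite mem_cat !inE eqxx !orbT.
have -> : v = b.
  by apply: (card_le1_eqP oa); rewrite inE // /useful_arc /= ab ua ub.
by rewrite mem_cat !inE eqxx !orbT.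
Qed.

Lemma candidates_useful : {subset candidates <= useful}.
Proof.
move=> x; rewrite !inE => /predU1P[->|/existsP[a /andP[/and3P[_ _ ux] _]]] //.
by rewrite -topredE /= usefulE connect0.
Qed.

(** Trackers that are not useful lie on no s-t path and are dropped, the others are replaced by
    candidates on the same paths. Paths which agree on the new set thus agree on [T0]. The successor
    in the bound is for s. *)
Lemma tracking_candidates T0 : tracking_set G s t T0 ->
  exists T : {set 'I_n}, [/\ T \subset candidates, s \in T, #|T| <= #|T0|.+1 & good T].
Proof.
move=> tr0.
have [f Hf] : exists f : 'I_n -> 'I_n, forall v, useful v ->
    f v \in candidates /\ forall P, st_path G s t P -> (v \in P) = (f v \in P).
  apply: (@fin_all_exists _ _ (fun v x => useful v -> x \in candidates /\
    forall P, st_path G s t P -> (v \in P) = (x \in P))) => v.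
  case: (boolP (useful v)) => [/candidate_eqP[x cx Hx]|nv]; first by exists x.
  by exists v.
have sC : s \in candidates by rewrite !inE eqxx.
pose T := s |: f @: [set v in T0 | useful v].
have TC : T \subset candidates.
  apply/subsetP => x; case/setU1P=> [->//|/imsetP[v]].
  by rewrite inE => /andP[_ /Hf[cv _]] ->.
exists T; split=> //.
- exact: setU11.
- rewrite cardsU1 -add1n leq_add ?leq_b1 //.
  apply: leq_trans (leq_imset_card _ _) _; apply: subset_leq_card.
  by apply/subsetP => v; rewrite inE => /andP[].
- apply: tracking_good => [x /(subsetP TC)/candidates_useful //|P1 P2 st1 st2 ne E].
  apply: (tr0 P1 P2) => //; apply/setP => v; rewrite !inE.
  case: (boolP (v \in T0)) => //= vT; case: (boolP (useful v)) => [uv|nv].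
    have [_ Hv] := Hf v uv; rewrite !Hv //.
    have /setP/(_ (f v)) := E; rewrite !inE.
    by rewrite (_ : f v \in f @: _) ?orbT //; apply/imsetP; exists v; rewrite // inE vT.
  apply/idP/idP => vP; case/negP: nv; first exact: (useful_st_path st1).
  exact: (useful_st_path st2).
Qed.

(** * Degree sums and the number of candidates *)

Lemma sum_outdeg a : outdeg a = \sum_b useful_arc a b.
Proof. by rewrite /outdeg -sum1dep_card big_mkcond. Qed.

Lemma sum_indeg b : indeg b = \sum_a useful_arc a b.
Proof. by rewrite /indeg -sum1dep_card big_mkcond. Qed.

Lemma sum_pred1 (x : 'I_n) : \sum_y (y == x) = 1.
Proof. by rewrite (bigD1 x) //= eqxx big1 // => y /negbTE->. Qed.

(** Add the number of useful vertices to both sides. The left one is then at most the number of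
    useful arcs plus 1, as only s can lack a predecessor; the right one is at least that, as t is
    useful and has no successor. *)
Lemma indeg_outdeg_sum : \sum_b (indeg b).-1 <= \sum_a (outdeg a).-1.
Proof.
rewrite -(leq_add2r (\sum_v useful v)) -!big_split /=.
apply: (@leq_trans (\sum_b (indeg b + (b == s)))).
  apply: leq_sum => b _; case: (boolP (useful b)) => ub; last by lia.
  case: eqVneq => [_|/(pred_useful ub)[a ab]]; first by lia.
  suff : 0 < indeg b by lia.
  by apply/card_gt0P; exists a; rewrite inE.
rewrite big_split sum_pred1 /= -(sum_pred1 t).
under eq_bigr do rewrite sum_indeg.
rewrite exchange_big /=; under eq_bigr do rewrite -sum_outdeg.
rewrite -big_split /=; apply: leq_sum => a _.
case: (boolP (useful a)) => ua.
  case: eqVneq => [->|_]; last by lia.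
  suff -> : outdeg t = 0 by [].
  apply/eqP; rewrite cards_eq0 -subset0; apply/subsetP => b; rewrite !inE.
  case/and3P=> tb _; rewrite usefulE => /andP[_ /acyclic_arc].
  by rewrite tb.
have -> : outdeg a = 0.
  apply/eqP; rewrite cards_eq0 -subset0; apply/subsetP => b; rewrite !inE.
  by rewrite /useful_arc /= (negbTE ua) andbF.
by case: eqVneq ua => // ->; rewrite useful_target.
Qed.

(* The heads of the arcs leaving the explored vertices are distinct; they are
   explored and different from u, or they are trackers different from s. *)
Lemma explored_outdeg_sum (T : {set 'I_n}) u :
    s \in T -> {subset T <= useful} -> good T -> u \in T ->
  \sum_(v | explored G useful (mem T) u v) (outdeg v).-1 <= #|T|.-1.
Proof.
move=> sT TU /forall_inP gT uT; set E := explored _ _ _ _.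
pose H := [set x | [exists a, E a && useful_arc a x]].
have uE : E u by apply: connect0.
have sumH : \sum_(v | E v) outdeg v <= #|H|.
  under eq_bigr do rewrite sum_outdeg.
  rewrite exchange_big /= -sum1dep_card [X in _ <= X]big_mkcond /=.
  apply: leq_sum => x _; case: existsP => [_|nH]; last first.
    by rewrite big1 // => a aE; case ax: (useful_arc a x) => //; case: nH; exists a; rewrite aE.
  rewrite -big_mkcondr /= sum1dep_card; apply/card_le1_eqP => a b.
  rewrite !inE => /andP[aE /and3P[ax _ ux]] /andP[bE /and3P[bx _ _]].
  apply/eqP; apply: contraT => ab; case/negP: (gT _ uT); apply/orP; right.
  apply/existsP; exists a; apply/existsP; exists b; apply/existsP; exists x.
  by apply/and5P; split=> //; [by rewrite eq_sym | apply/andP].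
have subH : H \subset ([set v | E v] :\ u) :|: (T :\ s).
  apply/subsetP => x; rewrite !inE => /existsP[a /andP[aE /and3P[ax ua ux]]].
  have [ua' sa] : connect G u a /\ connect G s a.
    split; first exact: explored_connect aE.
    by move: ua; rewrite usefulE => /andP[].
  case: (boolP (x \in T)) => xT /=.
    suff -> : x != s by rewrite orbT.
    by apply: contraTneq ax => ->; apply: acyclic_arc.
  rewrite andbF orbF; apply/andP; split.
    by apply: contraTneq ax => ->; apply: acyclic_arc.
  by apply: connect_trans aE (connect1 _); rewrite /= ax ux.
have {subH} := leq_trans (subset_leq_card subH) (leq_card_setU _ _).
have := cardsD1 u [set v | E v]; rewrite inE uE /= add1n.
have := cardsD1 s T; rewrite sT /= add1n => -> cE cH.
rewrite -(leq_add2r #|[set v | E v]|) -[X in _ + X <= _]sum1dep_card -big_split /=.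
(* Among the explored vertices only t can have outdegree 0; it counts as one more leaf. *)
apply: (@leq_trans (\sum_(v | E v) (outdeg v + (v == t)))).
  apply: leq_sum => v vE; case: eqVneq => [_|vt]; first by lia.
  suff : 0 < outdeg v by lia.
  have uv : useful v.
    case/connectP: vE => p; case/lastP: p => [_ ->|p x]; first exact: TU.
    by rewrite rcons_path last_rcons => /andP[_ /and3P[_ ux _]] ->.
  by have [a va] := succ_useful uv vt; apply/card_gt0P; exists a; rewrite inE.
rewrite big_split /=.
have : \sum_(v | E v) (v == t) <= 1.
  by rewrite -(sum_pred1 t) big_mkcond /=; apply: leq_sum => v _; case: (E v).
by move=> le1; apply: leq_trans (leq_add sumH le1) _; rewrite cE addn1 addnS ltnS addnC.
Qed.

(** A useful v is explored from the last tracker on any path from s to v, so the |T| searches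
    together cover all useful vertices. *)
Lemma outdeg_sum (T : {set 'I_n}) :
    s \in T -> {subset T <= useful} -> good T ->
  \sum_v (outdeg v).-1 <= #|T| * #|T|.-1.
Proof.
move=> sT TU gT.
apply: (@leq_trans (\sum_(u in T) \sum_(v | explored G useful (mem T) u v) (outdeg v).-1)).
  rewrite (exchange_big_dep xpredT) //=; apply: leq_sum => v _.
  case: (boolP (useful v)) => [|nv]; last first.
    suff -> : outdeg v = 0 by [].
    apply/eqP; rewrite cards_eq0 -subset0; apply/subsetP => b; rewrite !inE.
    by rewrite /useful_arc /= (negbTE nv) andbF.
  rewrite usefulE => /andP[/connectP[p pp lp] vt].
  have [|c [u [d [E uT nd]]]] := @split_last_in _ (mem T) (s :: p); first by rewrite /= sT.
  have lv : last u d = v by have := congr1 (last s) E; rewrite last_cat /= -lp.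
  have : sorted G (c ++ u :: d) by rewrite -E.
  move=> /cat_sorted2[_ /= pd].
  rewrite (bigD1 u) /= ?leq_addr //; apply/andP; split=> //.
  rewrite -lv; apply: connect_explored => // x xd.
  rewrite nd // andbT usefulE (path_connect pp) ?E; last by rewrite mem_cat inE xd !orbT.
  apply: connect_trans vt; case/splitPr: xd pd lv => d1 d2.
  rewrite cat_path last_cat /= => /and3P[_ _ p2] <-.
  by apply/connectP; exists d2.
rewrite -sum_nat_const; apply: leq_sum => u uT; exact: explored_outdeg_sum.
Qed.

(* If e is the sum of the outdegrees minus 1, at most 2 e arcs leave vertices of
   outdegree at least 2, and at most e vertices have indegree at least 2. *)
Lemma card_candidates (T : {set 'I_n}) k :
    s \in T -> {subset T <= useful} -> good T -> #|T| <= k.+1 ->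
  #|candidates| <= max_candidates k.
Proof.
move=> sT TU gT Tk.
have le_sum : \sum_v (outdeg v).-1 <= k * k.+1.
  apply: leq_trans (outdeg_sum sT TU gT) _; rewrite mulnC; apply: leq_mul => //.
  by rewrite -ltnS (leq_trans _ Tk) // prednK // card_gt0; apply/set0Pn; exists s.
pose C1 := [set b | [exists a, useful_arc a b && (1 < outdeg a)]].
pose C2 := [set b | 1 < indeg b].
have cC1 : #|C1| <= 2 * \sum_v (outdeg v).-1.
  rewrite -sum1dep_card big_mkcond /= big_distrr /=.
  apply: (@leq_trans (\sum_b \sum_a (useful_arc a b && (1 < outdeg a)))).
    apply: leq_sum => b _; case: existsP => // -[a ab].
    by rewrite (bigD1 a) //= ab.
  rewrite exchange_big /=; apply: leq_sum => a _.
  case: (ltnP 1 (outdeg a)) => oa; last by rewrite big1 // => b _; rewrite andbF.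
  (* For d >= 2 one has d <= 2 (d - 1). *)
  by under eq_bigr do rewrite andbT; rewrite -sum_outdeg; lia.
have cC2 : #|C2| <= \sum_v (outdeg v).-1.
  apply: leq_trans indeg_outdeg_sum; rewrite -sum1dep_card big_mkcond /=.
  by apply: leq_sum => b _; case: ifP => //; lia.
have sub : candidates \subset s |: (C1 :|: C2).
  apply/subsetP => x; rewrite !inE => /predU1P[->|/existsP[a /andP[ax H]]].
    by rewrite eqxx.
  case/orP: H => H; last by rewrite H !orbT.
  by apply/orP; right; apply/orP; left; apply/existsP; exists a; rewrite ax.
have := leq_trans (subset_leq_card sub) (leq_card_setU _ _).
rewrite cards1 => /leq_trans; apply; rewrite /max_candidates addnC leq_add2r.
apply: leq_trans (leq_card_setU _ _) _; apply: leq_trans (leq_add cC1 cC2) _.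
by rewrite -mulSnr leq_mul2l le_sum.
Qed.

End Connected.

(** The bound on the candidates is part of the equivalence because the algorithm rejects as soon as
    it is exceeded. Removing s from T yields the k trackers, since s is on every s-t path. *)
Lemma tracking_pathsE k : tracking_paths G s t k <->
  #|candidates| <= max_candidates k /\
  exists T : {set 'I_n}, [/\ T \subset candidates, s \in T, #|T| <= k.+1 & good T].
Proof.
case: (boolP (connect G s t)) => [st|nst].
  split=> [[T0 [c0 tr0]]|[_ [T [TC sT cT gT]]]].
    have [T [TC sT cT gT]] := tracking_candidates st tr0.
    have cT' : #|T| <= k.+1 by apply: leq_trans cT _.
    split; last by exists T.
    apply: (card_candidates st sT _ gT cT') => x /(subsetP TC).
    exact: candidates_useful.
  exists (T :\ s); split; first by move: cT; rewrite (cardsD1 s T) sT.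
  move=> P1 P2 st1 st2 ne E; apply: (good_tracking st sT gT st1 st2 ne).
  apply/setP => v; have /setP/(_ v) := E; rewrite !inE.
  case: eqVneq => //= -> _; congr andb.
  by case: st1 st2 => q1 [-> _ _ _] [q2 [-> _ _ _]]; rewrite !inE eqxx.
(* Without s-t paths the answer is yes, and the right-hand side must agree: t is the only useful
   vertex, s the only candidate, and the search from s does not reach t. *)
have uE x : useful x -> x = t.
  by case/usefulW=> // -[sx xt]; case/negP: nst; apply: connect_trans xt.
have noarc a b : useful_arc a b = false.
  apply/negP => /and3P[ab /uE Ea /uE Eb]; rewrite Ea Eb in ab.
  by have := acyclic_arc (connect0 G t); rewrite ab.
have cE : candidates = [set s].
  apply/setP => x; rewrite !inE; case: eqVneq => //= _.
  by apply/existsP => -[a]; rewrite noarc.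
split=> [_|_].
  rewrite cE cards1; split; first by rewrite /max_candidates addn1.
  exists [set s]; rewrite inE cards1; split=> //.
  apply/forall_inP => u /set1P->; apply/negP => /orP[/existsP[a]|].
    case/and3P=> /(explored_connect (T := [set s]))/acyclic_arc/negbTE H as_.
    by rewrite H in as_.
  case/existsP=> a /existsP[b /existsP[x]].
  case/and5P=> _ /(explored_connect (T := [set s])) sa _ ax /andP[_ /uE Ex].
  case/negP: nst; rewrite -Ex; exact: connect_trans sa (connect1 ax).
exists set0; rewrite cards0; split=> // P1 P2 [q [_ pq lq _]].
by case/negP: nst; apply/connectP; exists q.
Qed.

End Dag.

(** * Graph exploration *)

(* Variables 0 and 1 hold the constants 0 and 1, variable 2 holds [n]. *)
Definition For (i h : nat) (c : cmd) : cmd :=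
  Lit i 0 ;; While i h (c ;; Plus i i 1).

Definition Clear (a : nat) : cmd := For 26 2 (Put a 26 0).

(* Depth-first search along the arcs listed in [first], [next] (linked lists)
   and [target], started at variable 9 and confined to the vertices [x] such
   that [allow[x]] is variable 8. Vertices marked in array 10 are not left.
   Array 11 is the stack, variable 20 the arc under consideration, 21 the height
   of the stack. Variable 27 becomes 1 when a vertex is met a second time. *)
Definition Explore (first next target allow vis : nat) : cmd :=
  Clear vis ;;
  Put vis 9 1 ;; Lit 27 0 ;; Get 20 first 9 ;; Lit 21 0 ;; Lit 25 1 ;;
  While 0 25 (
    IfLt 0 20
      (Get 23 target 20 ;; Get 20 next 20 ;; Get 24 allow 23 ;;
       IfEq 24 8
         (Get 24 vis 23 ;;
          IfLt 0 24 (Lit 27 1)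
            (Put vis 23 1 ;; Get 24 10 23 ;;
             IfLt 0 24 Skip (Put 11 21 23 ;; Plus 21 21 1)))
         Skip)
      (IfLt 0 21
        (Minus 21 21 1 ;; Get 22 11 21 ;; Get 20 first 22)
        (Lit 25 0))).

(** * Counting loops *)

Section Programs.
Variables (w B : nat).

(** A round costs at most d credits for the body and 2 for the test and the increment; the final 2
    pays for the initialization and the failing test. Starting the body with [d + t] credits and
    asking for [t <= t'] expresses its cost. *)
Lemma wp_for (I : nat -> regs -> arrays -> Prop) n d i h c Q t R A :
    i != 1 -> n < 2 ^ w ->
    (forall j R A, I j R A -> R h = n /\ R 1 = 1) ->
    I 0 (upd R i 0) A ->
    (forall j t R A, j < n -> R i = j -> I j R A ->
      wp w B c (fun t' R' A' =>
        [/\ t <= t', R' i = j & I j.+1 (upd R' i j.+1) A']) (d + t) R A) ->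
    n * (d + 2) + 2 <= t ->
    (forall t' R' A', R' i = n -> I n R' A' -> t <= t' + (n * (d + 2) + 2) ->
      Q t' R' A') ->
  wp w B (For i h c) Q t R A.
Proof.
move=> i1 nw Ih I0 Ic nt IQ; case: t nt IQ => [|t] nt IQ; first by lia.
split; first by apply: leq_ltn_trans nw.
exists (fun t' R' A' => exists j, [/\ j <= n, R' i = j, I j R' A' &
  t <= t' + j * (d + 2)]).
  by exists 0; split=> //; [rewrite /upd eqxx | rewrite addn0].
move=> t' R' A' [j [jn Ei Ij tj]]; have [Eh _] := Ih _ _ _ Ij.
case: t' tj => [|t'] tj; first by nia.
case: ifP; rewrite Ei Eh => lt.
  (* The credit beyond d is kept for the increment. *)
  have [u Eu] : exists u, t' = d + u.+1 by exists (t' - d.+1); nia.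
  rewrite Eu.
  apply: wp_mono (Ic _ u.+1 _ _ lt Ei Ij) => {Ei Ij Eh} u' R'' A'' [] /=.
  case: u' => // u' lu Ei Ij; have [_] := Ih _ _ _ Ij.
  rewrite /upd eq_sym (negbTE i1) => E1; rewrite Ei E1 addn1.
  split; first by lia.
  by exists j.+1; split=> //; [rewrite eqxx | nia].
have jE : j = n by lia.
by apply: IQ => //; [rewrite Ei | rewrite -jE | rewrite -jE; nia].
Qed.

Lemma wp_clear a n Q t R A :
    a < narr -> R 0 = 0 -> R 1 = 1 -> R 2 = n -> n < 2 ^ w -> n <= B ->
    3 * n + 2 <= t ->
    (forall t' R' A', (forall r : nat, r != 26 -> R' r = R r) ->
      (forall b : nat, b != a -> A' b = A b) -> (forall i, i < n -> A' a i = 0) ->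
      t <= t' + (3 * n + 2) -> Q t' R' A') ->
  wp w B (Clear a) Q t R A.
Proof.
move=> an R0 R1 R2 nw nB nt HQ.
apply: (wp_for (n := n) (d := 1) (I := fun j R' A' =>
  [/\ forall r, r != 26 -> R' r = R r, forall b, b != a -> A' b = A b
    & forall i, i < j -> A' a i = 0])) => //.
- by move=> j R' A' [ER _ _]; rewrite !ER.
- by split=> // r /negbTE r26; rewrite /upd r26.
- move=> j u R' A' jn Ei [ER EA Ea]; rewrite -[1 + u]/(u.+1) /=.
  split=> //; first by lia.
  split=> //; split.
  + by move=> r r26; rewrite /upd (negbTE r26) ER.
  + by move=> b ba; rewrite /upda (negbTE ba) EA.
  + move=> i; rewrite ltnS leq_eqVlt Ei ER // R0 /upda /upd eqxx.
    by case: eqVneq => // _ /= /Ea.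
- by lia.
- by move=> t' R' A' _ [ER EA Ea] lt; apply: HQ => //; lia.
Qed.

End Programs.

(** * Arcs as linked lists *)

Section OutArcs.
Variables (V : eqType) (src : nat -> V).

(* Arcs are numbered from 1, so that 0 can end a linked list. *)
Fixpoint out_arcs (v : V) (j : nat) : seq nat :=
  if j is i.+1 then
    if src i == v then i.+1 :: out_arcs v i else out_arcs v i
  else [::].

Lemma mem_out_arcs v j e :
  (e \in out_arcs v j) = [&& 0 < e, e <= j & src e.-1 == v].
Proof.
elim: j => [|j IH] /=; first by case: e.
case: eqP => E; rewrite ?inE IH; case: (eqVneq e j.+1) => [->|ne] /=.
- by rewrite E eqxx leqnn.
- by rewrite [e <= j.+1]leq_eqVlt (negbTE ne).
- by rewrite ltnn leqnn (introF eqP E).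
- by rewrite [e <= j.+1]leq_eqVlt (negbTE ne).
Qed.

Lemma out_arcs_uniq v j : uniq (out_arcs v j).
Proof. by elim: j => //= j IH; case: ifP => //= _; rewrite IH mem_out_arcs ltnn andbF. Qed.

(** Arcs are inserted at the front, so the tail of a list is the list as it was before its head was
    inserted. This is what the array [next] stores. *)
Lemma out_arcs_cons v j e l : out_arcs v j = e :: l ->
  exists2 i, i < j & [/\ e = i.+1, src i = v & l = out_arcs v i].
Proof.
elim: j => //= j IH; case: eqP => [E [<- <-]|_ /IH[i ij H]]; first by exists j.
by exists i => //; apply: ltnW.
Qed.

Lemma mem_flatten_out_arcs (D : seq V) m e :
  (e \in flatten [seq out_arcs d m | d <- D]) =
  [&& 0 < e, e <= m & src e.-1 \in D].
Proof.
apply/flatten_mapP/idP => [[d dD]|/and3P[e0 em eD]].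
  by rewrite mem_out_arcs => /and3P[-> -> /eqP->].
by exists (src e.-1); rewrite // mem_out_arcs e0 em /=.
Qed.

Lemma flatten_out_arcs_uniq (D : seq V) m :
  uniq D -> uniq (flatten [seq out_arcs d m | d <- D]).
Proof.
elim: D => //= d D IH /andP[dD /IH uD]; rewrite cat_uniq out_arcs_uniq uD andbT.
apply/hasPn => e; rewrite mem_flatten_out_arcs mem_out_arcs.
by case/and3P=> -> -> eD; apply: contraNneq dD => <-.
Qed.

(** Makes the search linear: distinct vertices have disjoint arc lists. *)
Lemma size_flatten_out_arcs (D : seq V) m :
  uniq D -> size (flatten [seq out_arcs d m | d <- D]) <= m.
Proof.
move=> /(@flatten_out_arcs_uniq _ m) uD; rewrite -{2}(size_iota 1 m).
apply: uniq_leq_size => // e; rewrite mem_flatten_out_arcs mem_iota add1n ltnS.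
by case/and3P=> -> ->.
Qed.

End OutArcs.

(** * Correctness and cost of the search *)

Section Explore.
Variables (w B n m : nat) (src tgt : nat -> 'I_n) (g : rel 'I_n).
Variables (al bl : pred 'I_n) (root : 'I_n).

Local Notation explored := (explored g al bl root).
Local Notation met := (met g al bl root).
Local Notation met_twice := (met_twice g al bl root).

Hypothesis arcP : forall a b,
  reflect (exists2 i, i < m & src i = a /\ tgt i = b) (g a b).

(** Repetitions are kept: [root :: heads done] records all meetings caused by the scanned arcs. *)
Definition heads (done : seq nat) : seq 'I_n :=
  [seq tgt e.-1 | e <- done & al (tgt e.-1)].

Lemma heads_rcons done e : heads (rcons done e) =
  if al (tgt e.-1) then rcons (heads done) (tgt e.-1) else heads done.
Proof. by rewrite /heads filter_rcons; case: ifP; rewrite ?map_rcons. Qed.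

Hypothesis arc_inj : forall i j, i < m -> j < m ->
  src i = src j -> tgt i = tgt j -> i = j.

Section Exploration.
Variable D : seq 'I_n.
Hypotheses (uD : uniq D) (explD : {subset D <= explored}).
Let done := flatten [seq out_arcs src d m | d <- D].
Hypothesis memD : forall x,
  (x \in D) = (x == root) || (x \in heads done) && ~~ bl x.

Lemma mem_heads x :
  reflect (exists a, [/\ a \in D, g a x & al x]) (x \in heads done).
Proof.
apply: (iffP mapP) => [[e]|[a [aD /arcP[i im [sa tx]] ax]]].
  rewrite mem_filter mem_flatten_out_arcs => /and4P[ax e0 em eD] ->.
  by exists (src e.-1); split=> //; apply/arcP; exists e.-1; rewrite ?prednK.
by exists i.+1; rewrite //= mem_filter mem_flatten_out_arcs /= tx sa ax im.
Qed.

(** By [memD], D contains the root and is closed under the steps of the search. *)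
Lemma memD_explored a : (a \in D) = explored a.
Proof.
apply/idP/idP => [/explD//|/connectP[p]].
have: root \in D by rewrite memD eqxx.
elim: p {1 2 3}root => [|b p IH] r rD /=; first by move=> _ ->.
case/andP=> /and3P[rb ab bb] /IH; apply.
by rewrite memD bb andbT; apply/orP; right; apply/mem_heads; exists r.
Qed.

Lemma mem_headsE x : (x \in root :: heads done) = met x.
Proof.
rewrite inE /met; congr orb; apply/mem_heads/existsP => -[a].
  by case=> aD ar ax; exists a; rewrite -memD_explored aD ar ax.
by case/and3P => aD ar ax; exists a; rewrite memD_explored.
Qed.

(** An arc is determined by its ends, so a repeated head comes from two arcs with different
    tails. *)
Lemma uniq_headsE : uniq (root :: heads done) = ~~ met_twice.
Proof.
rewrite /= negb_or; congr andb.
  congr negb; apply/mem_heads/existsP => -[a].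
    by case=> aD ar ax; exists a; rewrite -memD_explored aD ar ax.
  by case/and3P => aD ar ax; exists a; rewrite memD_explored.
apply/idP/idP => [uh|].
  apply/existsP => -[a /existsP[b /existsP[x /andP[/eqP ab]]]].
  rewrite -!memD_explored.
  case/and5P=> aD bD /arcP[i im [si ti]] /arcP[j jm [sj tj]] ax.
  apply: ab; rewrite -si -sj; congr src; apply: succn_inj.
  have inj (f : nat -> 'I_n) s : uniq (map f s) -> {in s &, injective f}.
    elim: s => //= y s IH /andP[ny /IH {}IH] u v; rewrite !inE.
    case/predU1P=> [->|us] /predU1P[->|vs] // E; last exact: IH.
      by case/negP: ny; rewrite E map_f.
    by case/negP: ny; rewrite -E map_f.
  apply: (inj _ _ uh); rewrite /= ?mem_filter ?mem_flatten_out_arcs ?ti ?tj //=.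
    by rewrite ax im si.
  by rewrite ax jm sj.
move/existsPn=> no; rewrite map_inj_in_uniq.
  exact/filter_uniq/flatten_out_arcs_uniq.
move=> e f; rewrite !mem_filter !mem_flatten_out_arcs.
case/and4P=> ae e0 em eD /and4P[af f0 fm fD] E.
have em' : e.-1 < m by rewrite prednK.
have fm' : f.-1 < m by rewrite prednK.
rewrite -(prednK e0) -(prednK f0); congr S; apply: arc_inj => //.
apply/eqP; apply: contraT => ne; case/existsP: (no (src e.-1)).
exists (src f.-1); apply/existsP; exists (tgt e.-1).
rewrite ne -!memD_explored eD fD ae andbT /=.
by apply/andP; split; apply/arcP; [exists e.-1 | exists f.-1].
Qed.

End Exploration.

Lemma uniq_size_ord (S : seq 'I_n) : uniq S -> size S <= n.
Proof. by move/card_uniqP <-; apply: leq_trans (max_card _) _; rewrite card_ord. Qed.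

(** Variables from 20 on are temporaries; a search preserves all those below 20. *)
Lemma low_neq r k : r < 20 -> 20 <= k -> (r == k) = false.
Proof. by move=> r20 k20; apply/eqP; lia. Qed.

(** Clearing the marks costs 3 credits per vertex; every arc scanned and every vertex popped costs
    at most 13, and no arc or vertex is handled twice. *)
Lemma wp_explore first next target allow vis va Q t (R : regs) (A : arrays) :
    vis < narr -> vis != 11 ->
    all (fun a => [&& a < narr, a != vis & a != 11])
      [:: first; next; target; allow; 10] ->
    R 0 = 0 -> R 1 = 1 -> R 2 = n -> R 8 = va -> R 9 = root ->
    n < 2 ^ w -> n <= B -> m < B ->
    (forall v : 'I_n, A first v = head 0 (out_arcs src v m)) ->
    (forall i, i < m -> A next i.+1 = head 0 (out_arcs src (src i) i)
      /\ A target i.+1 = tgt i) ->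
    (forall x : 'I_n, (A allow x == va) = al x) ->
    (forall x : 'I_n, (0 < A 10 x) = bl x) ->
    16 * (n + m) + 24 <= t ->
    (forall t' R' A', (forall r, r < 20 -> R' r = R r) ->
      R' 27 = met_twice ->
      (forall b : nat, b != vis -> b != 11 -> A' b = A b) ->
      (forall x : 'I_n, A' vis x = met x) ->
      t <= t' + (16 * (n + m) + 24) -> Q t' R' A') ->
  wp w B (Explore first next target allow vis) Q t R A.
Proof.
move=> visn vis11 /= /and5P[/and3P[fn fv f11] /and3P[xn xv x11]
  /and3P[gn gv g11] /and3P[an av a11] /andP[/andP[v10 _] _]].
move=> R0 R1 R2 R8 R9 nw nB mB HF HN Hal Hbl nt HQ.
apply: (wp_clear (n := n)) => //; first by lia.
move=> t1 R1' A1 ER EA Ez lt1.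
have [u1 Eu1] : exists u1, t1 = u1.+3.+2 by exists (t1 - 5); lia.
have rB : root < B by apply: leq_trans nB.
have w1 : 1 < 2 ^ w by have := ltn_ord root; lia.
rewrite Eu1 /=; split=> //; first by rewrite ER // R9.
split; first by lia.
split=> //; first by rewrite /upd /= ER // R9.
split; first by lia.
split=> //.
(* D lists the vertices whose arcs have been scanned or are being scanned, S is the stack, [done]
   holds the scanned arcs and [cur] the rest of the current list. The vertices of [D ++ S] are the
   root and the unblocked ones met so far. The last round costs 4 credits. *)
pose Inv t' (R' : regs) (A' : arrays) := exists (D S : seq 'I_n) (done cur : seq nat),
  [/\ [/\ forall r, r < 20 -> R' r = R r,
      forall b : nat, b != vis -> b != 11 -> A' b = A b,
      R' 25 = 1 \/ [/\ R' 25 = 0, S = [::] & cur = [::]] &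
      u1 <= t' + 13 * (size done + size D) + 4 * (R' 25 == 0)],
    [/\ R' 20 = head 0 cur, R' 21 = size S,
      forall i, i < size S -> A' 11 i = nth root S i,
      forall x : 'I_n, A' vis x = (x \in root :: heads done) &
      R' 27 = ~~ uniq (root :: heads done)],
    [/\ flatten [seq out_arcs src d m | d <- D] = done ++ cur &
      exists (v : 'I_n) (j : nat), [/\ v \in D, j <= m & cur = out_arcs src v j]],
    uniq (D ++ S) & [/\ {subset D ++ S <= explored} &
    forall x : 'I_n, (x \in D ++ S) = (x == root) || (x \in heads done) && ~~ bl x]].
exists Inv.
  exists [:: root], [::], [::], (out_arcs src root m); split=> //=.
  - split=> //.
    + by move=> r r20; rewrite /upd !ifF ?ER //; apply/eqP; lia.
    + by move=> b bv _; rewrite /upda (negbTE bv) EA.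
    + by left.
    + by rewrite /upd /=; lia.
  - split=> //; first by rewrite /upd /= /upda (negbTE fv) EA // ER // R9 HF.
    by move=> x; rewrite inE /upda eqxx /upd /= ER // R9 ER // R1 Ez //.
  - by split; [rewrite cats0 | exists root, m; rewrite inE eqxx].
  - by split=> x; rewrite inE ?orbF => // /eqP->; apply: connect0.
move=> t' R' A' [D [S [done [cur [[HR HA HG lt] [H20 H21 H11 Hvis H27] [Hd Hj] uDS [HE HM]]]]]].
have uD : uniq D by move: uDS; rewrite cat_uniq => /andP[].
have sD : size (D ++ S) <= n by apply: uniq_size_ord.
have sd : size (done ++ cur) <= m by rewrite -Hd; apply: size_flatten_out_arcs.
rewrite !size_cat in sD sd.
case: t' lt => [|t'] lt; first by case: (R' 25 == 0) lt => /=; lia.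
case: HG => [G1|[G0 S0 c0]]; last first.
  rewrite G0 HR // R0 /=; move: S0 c0 Hd uDS HM HE => -> ->; rewrite !cats0 => Hd uDS HM HE.
  apply: HQ => //.
  - by rewrite H27 -Hd uniq_headsE ?negbK // => x; rewrite HM Hd.
  - by move=> x; rewrite Hvis -Hd mem_headsE // => y; rewrite HM Hd.
  - by move: lt; rewrite G0 /=; lia.
rewrite G1 HR // R0 /=.
have [u Eu] : exists u, t' = u.+4.+4.+4 by exists (t' - 12); move: lt; rewrite G1 /=; lia.
move: lt; rewrite {t'}Eu G1 /= addn0 => lt.
rewrite H20.
case: cur H20 Hd Hj sd => [|e cur] H20 Hd Hj sd /=.
  rewrite H21; case: (lastP S) uDS H21 H11 HE HM sD => [|S' v] uDS H21 H11 HE HM sD /=.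
    split; first by lia.
    exists D, [::], done, [::]; split=> //; split=> //.
    - by move=> r r20; rewrite /upd !(low_neq r20) // HR.
    - by right; split.
    - by rewrite /upd /=; lia.
  rewrite size_rcons /= in sD H21 H11 *.
  split=> //; first by rewrite /upd /= HR // R1; have := size S'; lia.
  have top : A' 11 (size S') = v by rewrite H11 // nth_rcons ltnn eqxx.
  split=> //; first by rewrite /upd /= HR // R1 subn1 /= top; apply: leq_trans nB.
  have mv x : (x \in rcons D v ++ S') = (x \in D ++ rcons S' v).
    by rewrite !mem_cat !mem_rcons !inE; case: (x == v); rewrite ?orbT.
  exists (rcons D v), S', done, (out_arcs src v m); split=> //.
  - split=> //.
    + by move=> r r20; rewrite /upd !(low_neq r20) // HR.
    + by left.
    + by rewrite /upd /= size_rcons; clear -lt; lia.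
  - split=> //.
    + by rewrite /upd /= HR // R1 subn1 /= HA // top HF.
    + by rewrite /upd /= HR // R1 subn1.
    + move=> i iS; rewrite H11; last exact: ltnW.
      by rewrite nth_rcons iS.
  - split; first by rewrite map_rcons flatten_rcons Hd cats0.
    by exists v, m; rewrite mem_rcons inE eqxx.
  - rewrite cat_rcons; move: uDS.
    by rewrite (perm_uniq (s2 := D ++ v :: S')) // perm_cat2l perm_rcons.
  - by split=> x; rewrite mv; [apply: HE | apply: HM].
have [v [j [vD jm Ecur]]] := Hj.
have [i ij [Ee Es Ec]] := out_arcs_cons (esym Ecur).
have im : i < m by apply: leq_trans jm.
have [HNi HTi] := HN _ im.
have Hh : heads (rcons done e) =
    if al (tgt i) then rcons (heads done) (tgt i) else heads done.
  by rewrite heads_rcons Ee.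
have Hd' : flatten [seq out_arcs src d m | d <- D] = rcons done e ++ cur.
  by rewrite cat_rcons.
have Hj' : exists (v : 'I_n) (j : nat), [/\ v \in D, j <= m & cur = out_arcs src v j].
  by exists v, i; split=> //; apply: ltnW.
have AT : A' target e = tgt i by rewrite HA // Ee.
have AN : A' next e = head 0 cur by rewrite HA // Ee HNi Ec Es.
have AA : (A' allow (tgt i) == va) = al (tgt i) by rewrite HA.
rewrite {1}Ee /=.
have eB : e < B by rewrite Ee; apply: leq_trans mB.
have vB (x : 'I_n) : x < B by apply: leq_trans nB.
rewrite /upd /= H20 /= AT AN HR // R8 AA.
set x := tgt i in Hh AT AA *.
do 3![split=> //].
have Hvx : A' vis x = (x \in root :: heads done) := Hvis x.
have vE (y : 'I_n) : (y \in root :: rcons (heads done) x) =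
    (y == x) || (y \in root :: heads done).
  by rewrite -rcons_cons mem_rcons inE.
case: ifP => ax; rewrite ax in Hh; last first.
  exists D, S, (rcons done e), cur; rewrite Hh; split=> //; split=> //.
  - by move=> r r20; rewrite !(low_neq r20) // HR.
  - by left.
  - by rewrite size_rcons /=; clear -lt; lia.
split=> //; rewrite HR // R0 (HR 1) // R1 Hvx.
case: ifP => xh.
  have {}xh : x \in root :: heads done by case: (x \in _) xh.
  split=> //; exists D, S, (rcons done e), cur; rewrite Hh; split=> //.
  - split=> //.
    + by move=> r r20; rewrite !(low_neq r20) // HR.
    + by left.
    + by rewrite size_rcons /=; clear -lt; lia.
  - split=> //.
    + by move=> y; rewrite Hvis vE; case: eqVneq => // ->; rewrite xh.
    + by rewrite -rcons_cons rcons_uniq xh.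
  - split=> // y; rewrite HM mem_rcons inE.
    case: eqVneq => //= yr; case: (eqVneq y x) => //= yx.
    by move: xh; rewrite -yx inE (negbTE yr) => /= ->.
have {}xh : x \notin root :: heads done by case: (x \in _) xh.
have xr : x != root by apply: contraNneq xh => ->; rewrite inE eqxx.
have xS : x \notin D ++ S.
  rewrite HM (negbTE xr) /=; apply: contraNN xh => /andP[xh _].
  by rewrite inE xh orbT.
have visx b : b != vis -> upda A' vis x 1 b = A' b.
  by move=> bv; rewrite /upda (negbTE bv).
have vis'E (y : 'I_n) : upda A' vis x 1 vis y = (y \in root :: rcons (heads done) x).
  rewrite /upda eqxx /upd vE Hvis; case: (eqVneq y x) => [->|yx]; first by rewrite eqxx.
  by rewrite ifF //; apply: contraNF yx => /eqP/val_inj->.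
have uh : ~~ uniq (root :: rcons (heads done) x) = ~~ uniq (root :: heads done).
  by rewrite -rcons_cons rcons_uniq xh.
split=> //; split=> //; rewrite visx // HA // Hbl.
case: ifP => bx.
  exists D, S, (rcons done e), cur; rewrite Hh; split=> //.
  - split=> //.
    + by move=> r r20; rewrite !(low_neq r20) // HR.
    + by move=> b bv b11; rewrite visx // HA.
    + by left.
    + by rewrite size_rcons /=; clear -lt; lia.
  - split=> //; first by move=> k kS; rewrite visx 1?eq_sym // H11.
    by rewrite uh.
  - split=> // y; rewrite HM mem_rcons inE.
    by case: (eqVneq y x) => // ->; rewrite bx !andbF.
(* The stack holds distinct vertices, so it fits into its block. *)
have SB : size S < n.
  apply: (@uniq_size_ord (x :: S)); move: uDS xS => /=.
  by rewrite cat_uniq mem_cat negb_or => /and3P[_ _ ->] /andP[_ ->].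
split=> //; first by rewrite H21; apply: leq_trans nB.
split; first by rewrite H21; clear -SB nw w1; lia.
exists D, (rcons S x), (rcons done e), cur; rewrite Hh; split=> //.
- split=> //.
  + by move=> r r20; rewrite !(low_neq r20) // HR.
  + by move=> b bv b11; rewrite /upda (negbTE b11) (negbTE bv) HA.
  + by left.
  + by rewrite size_rcons /=; clear -lt; lia.
- split=> //.
  + by rewrite /= size_rcons H21 addn1.
  + move=> k; rewrite size_rcons ltnS nth_rcons /upda eqxx /upd H21.
    rewrite [11 == vis]eq_sym (negbTE vis11).
    by case: (ltngtP k (size S)) => // kS _; rewrite H11.
  + by move=> y; rewrite {1}/upda (negbTE vis11) vis'E.
  + by rewrite uh.
- by rewrite -rcons_cat rcons_uniq xS.
- split=> y; rewrite -rcons_cat mem_rcons inE.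
    case/predU1P=> [->|]; last exact: HE.
    apply: (connect_trans (y := v)).
      by apply: HE; rewrite mem_cat vD.
    apply: connect1; rewrite /= -/x bx andbT; apply/andP; split; last exact: ax.
    by apply/arcP; exists i.
  rewrite HM mem_rcons inE; case: (eqVneq y x) => [->|] //=.
  by rewrite bx (negbTE xr).
Qed.

End Explore.

(** * Tuples as numbers *)

Definition digit (N x j : nat) : nat := (x %/ N ^ j) %% N.

(** The carry into position j is 1 if and only if N^j divides the new number; this gives [Next] a
    closed invariant. *)
Lemma digitS N x j : 0 < N ->
  digit N x.+1 j = (digit N x j + (N ^ j %| x.+1)) %% N.
Proof. by move=> N0; rewrite /digit divnS ?expn_gt0 ?N0 // addnC modnDml. Qed.

Lemma dvdn_expSr N y j : 0 < N ->
  (N ^ j.+1 %| y) = (N ^ j %| y) && (N %| y %/ N ^ j).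
Proof.
move=> N0; have Nj : 0 < N ^ j by rewrite expn_gt0 N0.
rewrite expnSr; apply/idP/andP => [d|[d1]]; last by rewrite dvdn_divRL // mulnC.
have d1 : N ^ j %| y by apply: dvdn_trans d; apply: dvdn_mulr.
by rewrite dvdn_divRL // mulnC.
Qed.

Lemma carryS N x j : 0 < N ->
  (N ^ j.+1 %| x.+1) = (digit N x j + (N ^ j %| x.+1) == N).
Proof.
move=> N0; have Nj : 0 < N ^ j by rewrite expn_gt0 N0.
have dN : digit N x j < N by rewrite ltn_mod.
rewrite dvdn_expSr //; case d: (N ^ j %| x.+1) => /=; last by rewrite addn0 ltn_eqF.
rewrite divnS // d /dvdn -modnDmr -/(digit N x j) add1n addn1.
case: (eqVneq (digit N x j).+1 N) => [->|ne]; first by rewrite modnn eqxx.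
by rewrite modn_small // ltn_neqAle ne.
Qed.

Lemma digits_onto N k (d : nat -> nat) : (forall j, j < k -> d j < N) ->
  exists2 x, x < N ^ k & forall j, j < k -> digit N x j = d j.
Proof.
elim: k d => [|k IH] d dN; first by exists 0.
have N0 : 0 < N by apply: leq_ltn_trans (dN 0 _).
have [|x xN Hx] := IH (fun j => d j.+1); first by move=> j jk; apply: dN.
exists (x * N + d 0).
  rewrite expnSr; apply: (@leq_trans (x.+1 * N)); last by rewrite leq_mul2r xN orbT.
  by rewrite mulSnr ltn_add2l dN.
case=> [_|j jk]; first by rewrite /digit expn0 divn1 modnMDl modn_small // dN.
by rewrite -Hx // /digit expnS divnMA divnMDl // (divn_small (dN 0 isT)) addn0.
Qed.

(** * The algorithm *)

(* Variables: 2 n, 3 m, 4 s, 5 t, 6 k, 7 k + 1.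
   Arrays: 1 tails and 2 heads of the arcs; 3, 4 lists of the arcs by tail;
   5, 6 lists of the arcs by head. *)
Definition ReadInput : cmd :=
  Lit 1 1 ;; Get 2 0 0 ;; Get 3 0 1 ;; Lit 20 2 ;; Get 4 0 20 ;;
  Plus 20 20 1 ;; Get 5 0 20 ;; Plus 20 20 1 ;; Get 6 0 20 ;; Plus 7 6 1 ;;
  Plus 20 20 1 ;;
  For 17 3 (
    Get 21 0 20 ;; Plus 20 20 1 ;; Get 22 0 20 ;; Plus 20 20 1 ;;
    Plus 23 17 1 ;; Put 1 23 21 ;; Put 2 23 22 ;;
    Get 24 3 21 ;; Put 4 23 24 ;; Put 3 21 23 ;;
    Get 24 5 22 ;; Put 6 23 24 ;; Put 5 22 23).

(* Array 7 marks the vertices reached, array 8 the useful ones. *)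
Definition FindUseful : cmd :=
  Lit 8 0 ;; Copy 9 4 ;; Explore 3 4 2 10 7 ;;
  Lit 8 1 ;; Copy 9 5 ;; Explore 5 6 1 7 8.

(** Arrays 12 and 13 receive the outdegrees and indegrees with respect to useful arcs. *)
Definition FindDegrees : cmd :=
  For 17 3 (
    Plus 23 17 1 ;; Get 21 1 23 ;; Get 22 2 23 ;; Get 24 8 21 ;; Get 25 8 22 ;;
    IfLt 0 24
      (IfLt 0 25
        (Get 26 12 21 ;; Plus 26 26 1 ;; Put 12 21 26 ;;
         Get 26 13 22 ;; Plus 26 26 1 ;; Put 13 22 26)
        Skip)
      Skip).

(* Array 15 lists the candidates, variable 10 is their number. Both degrees
   are positive, so one of them exceeds 1 if and only if their sum exceeds 2. *)
Definition FindCandidates : cmd :=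
  Lit 10 1 ;; Put 15 0 4 ;; Put 14 4 1 ;; Lit 27 2 ;;
  For 17 3 (
    Plus 23 17 1 ;; Get 21 1 23 ;; Get 22 2 23 ;; Get 24 8 21 ;; Get 25 8 22 ;;
    IfLt 0 24
      (IfLt 0 25
        (Get 24 12 21 ;; Get 25 13 22 ;; Plus 24 24 25 ;;
         IfLt 27 24
           (Get 26 14 22 ;;
            IfLt 0 26 Skip (Put 14 22 1 ;; Put 15 10 22 ;; Plus 10 10 1))
           Skip)
        Skip)
      Skip).

(** Computes 3 k (k + 1) + 1 without multiplication: passing from j to j + 1 adds 6 (j + 1), the
    value of variable 16. *)
Definition FindLimit : cmd :=
  Lit 11 1 ;; Lit 16 6 ;; Lit 28 6 ;;
  For 17 6 (Plus 11 11 16 ;; Plus 16 16 28).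

(* Array 16 holds a k-tuple of indices of candidates, followed by 0, the index
   of [s]. Variable 14 is 1 if the test fails; the carry, variable 15, is still
   1 at the end of [Next] if all tuples have been tried. *)
Definition Test : cmd :=
  Clear 10 ;;
  For 17 7 (Get 20 16 17 ;; Get 20 15 20 ;; Put 10 20 1) ;;
  Lit 14 0 ;;
  For 17 7 (
    Get 20 16 17 ;; Get 9 15 20 ;; Explore 3 4 2 8 9 ;;
    IfLt 0 27 (Lit 14 1) Skip).

Definition Next : cmd :=
  Lit 15 1 ;;
  For 17 6 (
    Get 20 16 17 ;; Plus 20 20 15 ;;
    IfEq 20 10 (Lit 15 1 ;; Put 16 17 0) (Lit 15 0 ;; Put 16 17 20)).

(** Variable 12 is 1 as long as the enumeration goes on. Variable 13 is the answer; it is 0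
    beforehand. *)
Definition TryTuples : cmd :=
  Lit 12 1 ;;
  While 0 12 (
    Test ;;
    IfLt 0 14 (Next ;; IfLt 0 15 (Lit 12 0) Skip) (Lit 13 1 ;; Lit 12 0)).

Definition TrackingPaths : cmd :=
  ReadInput ;; FindUseful ;; FindDegrees ;; FindCandidates ;; FindLimit ;;
  IfLt 11 10 Skip TryTuples.

Opaque For Clear Explore.

Ltac bounds tac := repeat match goal with
  | |- is_true (_ < _) /\ _ => split; [by tac |]
  | |- and3 _ _ _ => split; [by [] | by tac |]
  end.

(** * Correctness of the algorithm, one phase after the other *)

Section Correctness.
Variables (w B n : nat) (G : rel 'I_n) (s t : 'I_n) (k : nat).
Variable es : seq ('I_n * 'I_n).

Local Notation m := (size es).
Local Notation src i := (nth (s, s) es i).1.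
Local Notation tgt i := (nth (s, s) es i).2.
Local Notation wp := (wp w B).

Hypothesis esG : perm_eq es (enum (arcs G)).
Hypotheses (sizeB : 5 + 2 * (n + m + k) <= B) (Bw : 2 * B <= 2 ^ w).

Variant consts (R : regs) : Prop :=
  Consts of forall r, r < 8 -> R r = nth 0 [:: 0; 1; n; m; val s; val t; k; k.+1] r.

Lemma consts_eq R R' : consts R -> (forall r, r < 8 -> R' r = R r) -> consts R'.
Proof. by case=> HR E; split=> r r8; rewrite E ?HR. Qed.

Lemma consts_upd R x v : 8 <= x -> consts R -> consts (upd R x v).
Proof.
by move=> x8 [HR]; split=> r r8; rewrite /upd ltn_eqF ?HR // (leq_trans r8).
Qed.

Lemma constsP R : consts R -> [/\ R 0 = 0, R 1 = 1, R 2 = n, R 3 = m &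
  [/\ R 4 = s, R 5 = t, R 6 = k & R 7 = k.+1]].
Proof. by case=> HR; rewrite !HR. Qed.

Lemma upd_ord (f : nat -> nat) (a b : 'I_n) x :
  upd f a x b = if a == b then x else f b.
Proof. by rewrite /upd val_eqE eq_sym. Qed.

Lemma head_out_arcs (f : nat -> 'I_n) v j : head 0 (out_arcs f v j.+1) =
  if f j == v then j.+1 else head 0 (out_arcs f v j).
Proof. by rewrite /=; case: ifP. Qed.

Definition linked (A : arrays) : Prop :=
  [/\ forall i, i < m -> A 1 i.+1 = src i /\ A 2 i.+1 = tgt i,
      forall v : 'I_n, A 3 v = head 0 (out_arcs (fun i => src i) v m),
      forall i, i < m -> A 4 i.+1 = head 0 (out_arcs (fun i => src i) (src i) i),
      forall v : 'I_n, A 5 v = head 0 (out_arcs (fun i => tgt i) v m) &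
      forall i, i < m -> A 6 i.+1 = head 0 (out_arcs (fun i => tgt i) (tgt i) i)].

Lemma mem_arcs a b : ((a, b) \in es) = G a b.
Proof. by rewrite (perm_mem esG) mem_enum inE. Qed.

Lemma arcs_uniq : uniq es.
Proof. by rewrite (perm_uniq esG) enum_uniq. Qed.

Lemma out_arcP a b : reflect (exists2 i, i < m & src i = a /\ tgt i = b) (G a b).
Proof.
rewrite -mem_arcs; apply: (iffP (nthP (s, s))) => [[i im E]|[i im [sa tb]]].
  by exists i; rewrite ?E.
by exists i; rewrite // [nth _ _ _]surjective_pairing sa tb.
Qed.

Lemma in_arcP a b :
  reflect (exists2 i, i < m & tgt i = a /\ src i = b) ([rel a b | G b a] a b).
Proof. by apply: (iffP (out_arcP b a)) => -[i im [? ?]]; exists i. Qed.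

Lemma out_arc_inj i j : i < m -> j < m -> src i = src j -> tgt i = tgt j -> i = j.
Proof.
move=> im jm Es Et; apply/eqP; rewrite -(nth_uniq (s, s) im jm arcs_uniq).
by rewrite [nth _ _ i]surjective_pairing Es Et -surjective_pairing.
Qed.

Lemma in_arc_inj i j : i < m -> j < m -> tgt i = tgt j -> src i = src j -> i = j.
Proof. by move=> im jm Et Es; apply: out_arc_inj. Qed.

Lemma nth_encode i : i < m ->
  nth 0 (encode es s t k) (5 + 2 * i) = src i /\
  nth 0 (encode es s t k) (5 + 2 * i).+1 = tgt i.
Proof.
rewrite -[5 + 2 * i]/((2 * i).+4.+1) /encode /=.
elim: es i => // e l IH [|i] // im.
by rewrite mulnS -[2 + 2 * i]/((2 * i).+2) /=; apply: IH.
Qed.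

Lemma wp_ReadInput Q t0 (A0 : arrays) :
    (forall i, A0 0 i = nth 0 (encode es s t k) i) ->
    (forall b i, 0 < b -> A0 b i = 0) ->
    15 * m + 20 <= t0 ->
    (forall t' R A, consts R -> linked A -> (forall b i, 6 < b -> A b i = 0) ->
      R 13 = 0 -> t0 <= t' + (15 * m + 20) -> Q t' R A) ->
  wp ReadInput Q t0 (fun=> 0) A0.
Proof.
move=> H0 Hz lt HQ.
have [u Eu] : exists u, t0 = 11 + u by exists (t0 - 11); lia.
rewrite Eu -[11 + u]/(u.+1.+1.+1.+4.+4) /= /upd /=.
have sn := ltn_ord s.
rewrite !H0 /=.
bounds lia.
apply: (wp_for (n := m) (d := 13) (I := fun j R A =>
  [/\ consts R, R 20 = 5 + 2 * j /\ R 13 = 0, forall i, A 0 i = A0 0 i,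
   [/\ forall i, i < j -> A 1 i.+1 = src i /\ A 2 i.+1 = tgt i,
      forall v : 'I_n, A 3 v = head 0 (out_arcs (fun i => src i) v j),
      forall i, i < j -> A 4 i.+1 = head 0 (out_arcs (fun i => src i) (src i) i),
      forall v : 'I_n, A 5 v = head 0 (out_arcs (fun i => tgt i) v j) &
      forall i, i < j -> A 6 i.+1 = head 0 (out_arcs (fun i => tgt i) (tgt i) i)] &
   forall b i, 6 < b -> A b i = 0])); [by [] | lia | | | | |].
- by move=> j R A [/constsP[]].
- split=> //.
  + by split; do 8![case=> [_|]; first by rewrite /upd /= ?addn1].
  + by split=> // v; rewrite Hz.
  + by move=> b i b6; rewrite Hz //; lia.
- move=> j u' R A jm E17 [HR [E20 E13] EA [L1 L3 L4 L5 L6] Az].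
  have [R0 R1 R2 R3 _] := constsP HR.
  have [Es Et] := nth_encode jm.
  have sB : src j < B by have := ltn_ord (src j); lia.
  have tB : tgt j < B by have := ltn_ord (tgt j); lia.
  rewrite -[13 + u']/(u'.+4.+4.+4.+1) /= /upd /= E17 E20 R1 !addn1 !EA !H0 Es Et.
  bounds lia.
  split.
  + by apply: (consts_eq HR) => r r8; rewrite !ifF //; apply/eqP; lia.
  + by rewrite /=; split; lia.
  + by [].
  + split.
    * move=> i; rewrite ltnS leq_eqVlt /upda /= /upd eqSS.
      by case: eqVneq => [->|_] //= /L1.
    * by move=> v; rewrite head_out_arcs /upda /= -L3 upd_ord.
    * move=> i; rewrite ltnS leq_eqVlt /upda /= /upd eqSS.
      by case: eqVneq => [->|_] //= /L4.
    * by move=> v; rewrite head_out_arcs /upda /= -L5 upd_ord.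
    * move=> i; rewrite ltnS leq_eqVlt /upda /= /upd eqSS.
      by case: eqVneq => [->|_] //= /L6.
  + by move=> b i b6; rewrite /upda !ifF ?Az //; apply/eqP; lia.
- by lia.
- move=> t' R A _ [HR [_ R13] _ [L1 L3 L4 L5 L6] Az] le; apply: HQ => //.
  by lia.
Qed.

Lemma linked_eq A A' : linked A -> (forall b, b < 7 -> A' b = A b) -> linked A'.
Proof. by case=> L1 L3 L4 L5 L6 E; split=> *; rewrite !E; auto. Qed.

Lemma wp_FindUseful Q t0 (R : regs) (A : arrays) :
    consts R -> linked A -> (forall b i, 6 < b -> A b i = 0) -> R 13 = 0 ->
    32 * (n + m) + 60 <= t0 ->
    (forall t' R' A', consts R' -> R' 8 = 1 -> R' 13 = 0 -> linked A' ->
      (forall x : 'I_n, A' 8 x = useful G s t x) ->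
      (forall b i, 11 < b -> A' b i = 0) ->
      t0 <= t' + (32 * (n + m) + 60) -> Q t' R' A') ->
  wp FindUseful Q t0 R A.
Proof.
move=> HR HL Az R13 lt HQ.
have [u Eu] : exists u, t0 = u.+2 by exists (t0 - 2); lia.
have sn := ltn_ord s.
rewrite Eu /=; split; first by lia.
have HR' := HR; have [R0 R1 R2 R3 [R4 R5 _ _]] := constsP HR.
have [L1 L3 L4 L5 L6] := HL.
(* Array 10 is still 0 everywhere: compared with 0 it allows every vertex, and it blocks none. *)
apply: (@wp_explore w B n m (fun i => src i) (fun i => tgt i) G xpredT xpred0 s
  out_arcP out_arc_inj 3 4 2 10 7 0) => //; try lia.
- by move=> i im; rewrite L4 //; have [_ ->] := L1 i im.
- by move=> x; rewrite Az.
- by move=> x; rewrite Az.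
move=> t1 R1' A1 ER1 _ EA1 Ev lt1.
have [u1 Eu1] : exists u1, t1 = u1.+2 by exists (t1 - 2); lia.
rewrite Eu1; split; first by lia.
have {}HR : consts R1'.
  by apply: (consts_eq HR) => r r8; rewrite ER1 ?/upd ?ifF //; try apply/eqP; lia.
have {}HL : linked A1.
  by apply: (linked_eq HL) => b b7; rewrite EA1 //; apply/eqP; lia.
have [R1'0 R1'1 R1'2 R1'3 [R1'4 R1'5 _ _]] := constsP HR.
have [M1 M3 M4 M5 M6] := HL.
apply: (@wp_explore w B n m (fun i => tgt i) (fun i => src i) [rel a b | G b a]
  (reached G s) xpred0 t in_arcP in_arc_inj 5 6 1 7 8 1) => //; try lia.
- by move=> i im; rewrite M6 //; have [-> _] := M1 i im.
- by move=> x; rewrite Ev -/(reached G s x); case: (reached _ _ _).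
- by move=> x; rewrite EA1 // Az.
move=> t2 R2' A2 ER2 _ EA2 Eu2 lt2; apply: HQ => //.
- by apply: (consts_eq HR) => r r8; rewrite ER2 ?/upd ?ifF //; try apply/eqP; lia.
- by rewrite ER2.
- by rewrite ER2 // /upd /= ER1.
- by apply: (linked_eq HL) => b b7; rewrite EA2 //; apply/eqP; lia.
- by move=> b i b11; rewrite EA2 ?EA1 ?Az //; try apply/eqP; lia.
- by lia.
Qed.

Lemma iotaS j : iota 0 j.+1 = rcons (iota 0 j) j.
Proof. by rewrite -addn1 iotaD cats1. Qed.

(** The degree within the first j arcs, for use in loop invariants; f is the tail or the head
    function. *)
Definition degree (f : nat -> 'I_n) (j : nat) (v : 'I_n) : nat :=
  count (fun i => [&& useful G s t (src i), useful G s t (tgt i) & f i == v]) (iota 0 j).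

Lemma degreeS f j v : degree f j.+1 v =
  [&& useful G s t (src j), useful G s t (tgt j) & f j == v] + degree f j v.
Proof. by rewrite /degree iotaS -cats1 count_cat /= addn0 addnC. Qed.

Lemma degree_le f j v : degree f j v <= j.
Proof. by apply: leq_trans (count_size _ _) _; rewrite size_iota. Qed.

(** No arc is listed twice, so the arcs counted at v have different heads. *)
Lemma outdeg_degree v : outdeg G s t v = degree (fun i => src i) m v.
Proof.
rewrite /degree -size_filter -(size_map (fun i => tgt i)).
rewrite -(card_uniqP _); last first.
  rewrite map_inj_in_uniq ?filter_uniq ?iota_uniq // => i j.
  rewrite !mem_filter !mem_iota => /andP[/and3P[_ _ /eqP si] im] /andP[/and3P[_ _ /eqP sj] jm].
  by apply: out_arc_inj => //; rewrite si sj.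
apply: eq_card => b; rewrite inE; apply/and3P/mapP => [[/out_arcP[i im [sv tb]] uv ub]|[i]].
  by exists i; rewrite // mem_filter mem_iota sv tb uv ub eqxx.
rewrite mem_filter mem_iota => /andP[/and3P[us ut /eqP <-] im] ->.
by split=> //; apply/out_arcP; exists i.
Qed.

Lemma indeg_degree v : indeg G s t v = degree (fun i => tgt i) m v.
Proof.
rewrite /degree -size_filter -(size_map (fun i => src i)).
rewrite -(card_uniqP _); last first.
  rewrite map_inj_in_uniq ?filter_uniq ?iota_uniq // => i j.
  rewrite !mem_filter !mem_iota => /andP[/and3P[_ _ /eqP si] im] /andP[/and3P[_ _ /eqP sj] jm].
  by apply: in_arc_inj => //; rewrite si sj.
apply: eq_card => a; rewrite inE; apply/and3P/mapP => [[/out_arcP[i im [sv tb]] ua uv]|[i]].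
  by exists i; rewrite // mem_filter mem_iota sv tb ua uv eqxx.
rewrite mem_filter mem_iota => /andP[/and3P[us ut /eqP <-] im] ->.
by split=> //; apply/out_arcP; exists i.
Qed.

Lemma wp_FindDegrees Q t0 (R : regs) (A : arrays) :
    consts R -> linked A -> (forall x : 'I_n, A 8 x = useful G s t x) ->
    (forall i, A 12 i = 0) -> (forall i, A 13 i = 0) ->
    15 * m + 2 <= t0 ->
    (forall t' R' A', consts R' -> R' 8 = R 8 -> R' 13 = R 13 ->
      (forall b : nat, b != 12 -> b != 13 -> A' b = A b) ->
      (forall v : 'I_n, A' 12 v = outdeg G s t v) ->
      (forall v : 'I_n, A' 13 v = indeg G s t v) ->
      t0 <= t' + (15 * m + 2) -> Q t' R' A') ->
  wp FindDegrees Q t0 R A.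
Proof.
move=> HR [L1 _ _ _ _] Hu Hz12 Hz13 lt HQ.
apply: (wp_for (n := m) (d := 13) (I := fun j R' A' =>
  [/\ consts R', R' 8 = R 8 /\ R' 13 = R 13,
    forall b : nat, b != 12 -> b != 13 -> A' b = A b,
    forall v : 'I_n, A' 12 v = degree (fun i => src i) j v &
    forall v : 'I_n, A' 13 v = degree (fun i => tgt i) j v])); [by [] | lia | | | | |].
- by move=> j R' A' [/constsP[]].
- by split=> //; apply: consts_upd.
- move=> j u R' A' jm E17 [HR' [E8 E13] EA D12 D13].
  have [R0 R1 R2 R3 _] := constsP HR'.
  have [L1j L2j] := L1 _ jm.
  have sB : src j < B by have := ltn_ord (src j); lia.
  have tB : tgt j < B by have := ltn_ord (tgt j); lia.
  rewrite -[13 + u]/(u.+4.+4.+4.+1) /= /upd /= E17 R1 !addn1.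
  rewrite (EA 1) // (EA 2) // (EA 8) // L1j L2j !Hu R0 lt0b.
  have keep R'' : (forall r, r < 20 -> r != 17 -> R'' r = R' r) -> consts R''.
    by move=> E; apply: (consts_eq HR') => r r8; rewrite E //; try apply/eqP; lia.
  bounds lia.
  case us: (useful G s t (src j)); last first.
    split; [lia | by [] | split].
    + by apply: keep => r r20 /negbTE->; rewrite !(low_neq r20).
    + by [].
    + by [].
    + by move=> v; rewrite degreeS us D12.
    + by move=> v; rewrite degreeS us D13.
  rewrite lt0b; case ut: (useful G s t (tgt j)); last first.
    split; [lia | by [] | split].
    + by apply: keep => r r20 /negbTE->; rewrite !(low_neq r20).
    + by [].
    + by [].
    + by move=> v; rewrite degreeS us ut D12.
    + by move=> v; rewrite degreeS us ut D13.
  have le12 := degree_le (fun i => src i) j (src j).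
  have le13 := degree_le (fun i => tgt i) j (tgt j).
  rewrite !D12 {1 2}/upda /= D13.
  bounds lia; split.
  + by apply: keep => r r20 /negbTE->; rewrite !(low_neq r20).
  + by [].
  + by move=> b b12 b13; rewrite /upda (negbTE b12) (negbTE b13) EA.
  + by move=> v; rewrite degreeS us ut /= {1}/upda /= {1}/upda /= upd_ord D12; case: eqP => // ->.
  + by move=> v; rewrite degreeS us ut /upda /= upd_ord !D13; case: eqP => // ->.
- by lia.
- move=> t' R' A' _ [HR' [E8 E13] EA D12 D13] le; apply: HQ => //.
  + by move=> v; rewrite D12 outdeg_degree.
  + by move=> v; rewrite D13 indeg_degree.
  + by lia.
Qed.

Lemma wp_FindCandidates Q t0 (R : regs) (A : arrays) :
    consts R -> linked A -> (forall x : 'I_n, A 8 x = useful G s t x) ->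
    (forall v : 'I_n, A 12 v = outdeg G s t v) ->
    (forall v : 'I_n, A 13 v = indeg G s t v) ->
    (forall i, A 14 i = 0) ->
    18 * m + 10 <= t0 ->
    (forall t' R' A' (X : seq 'I_n), consts R' -> R' 8 = R 8 -> R' 13 = R 13 ->
      (forall b : nat, b != 14 -> b != 15 -> A' b = A b) ->
      uniq X -> X =i candidates G s t -> nth s X 0 = s -> R' 10 = size X ->
      (forall i, i < size X -> A' 15 i = nth s X i) ->
      t0 <= t' + (18 * m + 10) -> Q t' R' A') ->
  wp FindCandidates Q t0 R A.
Proof.
move=> HR [L1 _ _ _ _] Hu D12 D13 Hz lt HQ.
have [u Eu] : exists u, t0 = u.+4 by exists (t0 - 4); lia.
have sn := ltn_ord s; have [R0 R1 R2 R3 [R4 R5 _ _]] := constsP HR.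
rewrite Eu /= /upd /= R0 R1 R4; bounds lia.
pose chosen i x := [&& useful_arc G s t (src i) (tgt i), tgt i == x &
  (1 < outdeg G s t (src i)) || (1 < indeg G s t (tgt i))].
apply: (wp_for (n := m) (d := 16) (I := fun j R' A' =>
  [/\ consts R', [/\ R' 8 = R 8, R' 13 = R 13 & R' 27 = 2],
    forall b : nat, b != 14 -> b != 15 -> A' b = A b &
    exists X : seq 'I_n, [/\ uniq X,
      forall x : 'I_n, (x \in X) = (x == s) || has (chosen^~ x) (iota 0 j),
      0 < size X /\ nth s X 0 = s, R' 10 = size X &
      forall i, i < size X -> A' 15 i = nth s X i] /\
    forall x : 'I_n, A' 14 x = (x \in X)])); [by [] | lia | | | | |].
- by move=> j R' A' [/constsP[]].
- split=> //.
  + by apply: (consts_eq HR) => r r8; rewrite /upd !ifF //; apply/eqP; lia.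
  + by move=> b b14 b15; rewrite /upda (negbTE b14) (negbTE b15).
  + exists [:: s]; split.
      by split=> //; case.
    by move=> x; rewrite inE /upda /= /upd Hz val_eqE; case: eqP.
- move=> j u' R' A' jm E17 [HR' E8 EA [X [[uX memX [X0 Xs] E10 EX] E14]]].
  have [R'0 R'1 R'2 R'3 _] := constsP HR'.
  have [L1j L2j] := L1 _ jm.
  have sB : src j < B by have := ltn_ord (src j); lia.
  have tB : tgt j < B by have := ltn_ord (tgt j); lia.
  have [odn idn] : outdeg G s t (src j) <= n /\ indeg G s t (tgt j) <= n.
    by split; rewrite -[X in _ <= X](card_ord n) max_card.
  have Xn : size X <= n by apply: uniq_size_ord.
  have uaE : useful_arc G s t (src j) (tgt j) =
      useful G s t (src j) && useful G s t (tgt j).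
    rewrite /useful_arc /= (introT (out_arcP _ _)) //; by exists j.
  rewrite -[16 + u']/(u'.+4.+4.+4.+4) /= /upd /= E17 R'1 !addn1.
  rewrite (EA 1) // (EA 2) // (EA 8) // (EA 12) // (EA 13) // L1j L2j !Hu R'0 lt0b.
  rewrite D12 D13.
  have keep R'' : (forall r, r < 20 -> r != 17 -> r != 10 -> R'' r = R' r) -> consts R''.
    by move=> E; apply: (consts_eq HR') => r r8; rewrite E //; try apply/eqP; lia.
  (* The list stays as it is when arc j selects no vertex or one already listed. *)
  have skip : (forall x, chosen j x = false) \/
      tgt j \in X /\ (forall x, chosen j x -> x = tgt j) ->
    exists X : seq 'I_n, [/\ uniq X,
      forall x : 'I_n, (x \in X) = (x == s) || has (chosen^~ x) (iota 0 j.+1),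
      0 < size X /\ nth s X 0 = s, R' 10 = size X &
      forall i, i < size X -> A' 15 i = nth s X i] /\
    forall x : 'I_n, A' 14 x = (x \in X).
    move=> H; exists X; split=> //; split=> // x; rewrite iotaS has_rcons orbCA -memX.
    case: H => [->//|[tX H]]; case cx: (chosen j x) => //.
    by rewrite (H _ cx) tX.
  bounds lia.
  case us: (useful G s t (src j)); last first.
    split; [lia | by [] | split].
    + by apply: keep => r r20 /negbTE-> _; rewrite !(low_neq r20).
    + by [].
    + by [].
    + by apply: skip; left=> x; rewrite /chosen uaE us.
  rewrite lt0b; case ut: (useful G s t (tgt j)); last first.
    split; [lia | by [] | split].
    + by apply: keep => r r20 /negbTE-> _; rewrite !(low_neq r20).
    + by [].
    + by [].
    + by apply: skip; left=> x; rewrite /chosen uaE us ut.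
  bounds lia.
  have o0 : 0 < outdeg G s t (src j).
    by apply/card_gt0P; exists (tgt j); rewrite inE uaE us.
  have i0 : 0 < indeg G s t (tgt j).
    by apply/card_gt0P; exists (src j); rewrite inE uaE us.
  case: E8 => E8 E13 E27; rewrite E27.
  have cE x : chosen j x = (tgt j == x) && (2 < outdeg G s t (src j) + indeg G s t (tgt j)).
    by rewrite /chosen uaE us ut /=; congr andb; apply/orP/idP; lia.
  case: ifP => big; last first.
    split; [lia | by [] | split].
    + by apply: keep => r r20 /negbTE-> _; rewrite !(low_neq r20).
    + by [].
    + by [].
    + by apply: skip; left=> x; rewrite cE big andbF.
  rewrite E14; bounds lia; rewrite lt0b.
  case: (boolP (tgt j \in X)) => tX.
    split; [lia | by [] | split].
    + by apply: keep => r r20 /negbTE-> _; rewrite !(low_neq r20).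
    + by [].
    + by [].
    + by apply: skip; right; split=> // x; rewrite cE => /andP[/eqP].
  have SX : size X < n by apply: (@uniq_size_ord _ (tgt j :: X)); rewrite /= tX.
  rewrite E10; bounds lia; split.
  + by apply: keep => r r20 /negbTE-> /negbTE->; rewrite !(low_neq r20).
  + by [].
  + by move=> b b14 b15; rewrite /upda (negbTE b14) (negbTE b15) EA.
  + exists (rcons X (tgt j)); split; last first.
      move=> x; rewrite mem_rcons inE /upda /= upd_ord E14 [x == _]eq_sym.
      by case: (_ == _).
    split.
    * by rewrite rcons_uniq tX.
    * move=> x; rewrite -[chosen 0 x || _]/(has (chosen^~ x) (iota 0 j.+1)).
      by rewrite iotaS has_rcons mem_rcons inE cE big andbT [x == _]eq_sym memX orbCA.
    * by rewrite size_rcons nth_rcons X0.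
    * by rewrite size_rcons.
    * move=> i; rewrite size_rcons ltnS nth_rcons /upda /= /upd.
      by case: (ltngtP i (size X)) => // iX _; rewrite EX.
- by lia.
- move=> t' R' A' _ [HR' [E8 E13 _] EA [X [[uX memX [X0 Xs] E10 EX] _]]] le.
  apply: (HQ _ _ _ X) => //; last by lia.
  move=> x; rewrite memX !inE; congr orb; apply/hasP/existsP => [[i]|[a]].
    rewrite mem_iota => im /and3P[ua /eqP <- H]; exists (src i).
    by rewrite ua.
  case/andP=> ua H; have /and3P[/out_arcP[i im [Es Et]] _ _] := ua.
  by exists i; rewrite ?mem_iota // /chosen Es Et ua eqxx.
Qed.

Lemma wp_FindLimit Q t0 (R : regs) (A : arrays) :
    6 * k.+2 + max_candidates k.+1 < 2 ^ w ->
    consts R -> 4 * k + 6 <= t0 ->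
    (forall t' R', consts R' ->
      (forall r, r < 20 -> r \notin [:: 11; 16; 17] -> R' r = R r) ->
      R' 11 = max_candidates k ->
      t0 <= t' + (4 * k + 6) -> Q t' R' A) ->
  wp FindLimit Q t0 R A.
Proof.
move=> limit_w HR lt HQ.
have [u Eu] : exists u, t0 = u.+3 by exists (t0 - 3); lia.
have [R0 R1 R2 R3 _] := constsP HR.
rewrite Eu /=; bounds lia.
have E11 : 11 \in [:: 11; 16; 17] by [].
have E16 : 16 \in [:: 11; 16; 17] by [].
have E17 : 17 \in [:: 11; 16; 17] by [].
apply: (wp_for (n := k) (d := 2) (I := fun j R' A' =>
  [/\ consts R', A' = A, forall r, r < 20 -> r \notin [:: 11; 16; 17] -> R' r = R r,
    R' 11 = max_candidates j & R' 16 = 6 * j.+1 /\ R' 28 = 6])); [by [] | lia | | | | |].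
- by move=> j R' A' [/constsP[_ R'1 _ _ [_ _ -> _]]].
- split=> //.
  + by apply: (consts_eq HR) => r r8; rewrite /upd !ifF //; apply/eqP; lia.
  + move=> r r20; rewrite !inE !negb_or /upd => /and3P[/negbTE-> /negbTE-> /negbTE->].
    by rewrite (low_neq r20).
- move=> j u' R' A' jk F17 [HR' -> E F11 [F16 F28]].
  rewrite -[2 + u']/(u'.+2) /= /upd /= F11 F16 F28.
  have jk' : j * j.+1 <= k * k.+1 by apply: leq_mul; lia.
  have mj : max_candidates j + 6 * j.+1 = max_candidates j.+1 by rewrite /max_candidates; nia.
  have mk : max_candidates j.+1 <= max_candidates k.+1.
    by rewrite /max_candidates leq_add2r leq_mul2l leq_mul //=; lia.
  bounds lia; split=> //.
  + by apply: (consts_eq HR') => r r8; rewrite /upd !ifF //; apply/eqP; lia.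
  + move=> r r20 rn; rewrite -(E _ r20 rn).
    by move: rn; rewrite !inE !negb_or => /and3P[/negbTE-> /negbTE-> /negbTE->].
  + by rewrite /=; split=> //; lia.
- by lia.
- move=> t' R' A' _ [HR' -> E F11 _] le; apply: HQ => //; lia.
Qed.

Section Tuple.
Variable tup : nat -> 'I_n.

Definition tuple_set : {set 'I_n} := [set v | has (fun i => v == tup i) (iota 0 k.+1)].

(** Each of the k + 1 searches is linear; as n > 0, all additive constants are absorbed by the
    factor 70. *)
Lemma wp_Test Q t0 (R : regs) (A : arrays) :
    consts R -> linked A -> R 8 = 1 -> (forall x : 'I_n, A 8 x = useful G s t x) ->
    (forall i, i <= k -> A 16 i < B /\ A 15 (A 16 i) = tup i) ->
    70 * (k.+1 * (n + m)) <= t0 ->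
    (forall t' R' A', consts R' ->
      (forall r, r < 20 -> r \notin [:: 9; 14; 17] -> R' r = R r) ->
      R' 14 = ~~ good G s t tuple_set ->
      (forall b : nat, b \notin [:: 9; 10; 11] -> A' b = A b) ->
      t0 <= t' + 70 * (k.+1 * (n + m)) -> Q t' R' A') ->
  wp Test Q t0 R A.
Proof.
move=> HR HL R8 Hu Htup lt HQ.
have [R0 R1 R2 R3 [R4 R5 R6 R7]] := constsP HR.
have n0 : 0 < n by apply: leq_ltn_trans (ltn_ord s).
have lek : 1 <= k.+1 <= k.+1 * (n + m) by nia.
have len : n + m <= k.+1 * (n + m) by nia.
apply: wp_seq; apply: (wp_clear (n := n)); [by [] | by [] | by [] | by [] | lia | lia | nia | ].
move=> t1 R1' A1 ER EA Ez lt1.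
apply: wp_seq; apply: (wp_for (n := k.+1) (d := 3) (I := fun j R' A' =>
  [/\ consts R', forall r, r < 20 -> r != 17 -> R' r = R r,
    forall b : nat, b != 10 -> A' b = A b &
    forall v : 'I_n, A' 10 v = has (fun i => v == tup i) (iota 0 j)]));
  [by [] | lia | | | | nia |].
- by move=> j R' A' [/constsP[_ R'1 _ _ [_ _ _ ->]]].
- split=> //.
  + by apply: (consts_eq HR) => r r8; rewrite /upd ifF ?ER //; apply/eqP; lia.
  + by move=> r r20 /negbTE r17; rewrite /upd r17 ER // (low_neq r20).
  + by move=> v; rewrite Ez.
- move=> j u R' A' jk E17 [HR' E EA' E10].
  have [_ R'1 _ _ _] := constsP HR'.
  have [dB Edj] := Htup j jk.
  rewrite -[3 + u]/(u.+3) /= /upd /= E17 EA' // EA' // Edj R'1.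
  have tB : tup j < B by have := ltn_ord (tup j); lia.
  bounds lia; split.
  + by apply: (consts_eq HR') => r r8; rewrite !ifF //; apply/eqP; lia.
  + by move=> r r20 r17; rewrite (negbTE r17) (low_neq r20) // E.
  + by move=> b b10; rewrite /upda (negbTE b10) EA'.
  + move=> v; rewrite -[X in nat_of_bool X]/(has (fun i => v == tup i) (iota 0 j.+1)).
    by rewrite iotaS has_rcons /upda /= upd_ord E10 [v == _]eq_sym; case: (_ == _).
move=> t2 R2' A2 E17 [HR2 ER2 EA2 E10] lt2.
have [u Eu] : exists u, t2 = u.+1 by exists t2.-1; nia.
apply: wp_seq; rewrite Eu; split; first by lia.
apply: (wp_for (n := k.+1) (d := 16 * (n + m) + 24 + 4) (I := fun j R' A' =>
  [/\ consts R', forall r, r < 20 -> r \notin [:: 9; 14; 17] -> R' r = R r,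
    forall b : nat, b \notin [:: 9; 11] -> A' b = A2 b &
    R' 14 = has (fun i => met_twice G (useful G s t) (mem tuple_set) (tup i)) (iota 0 j)]));
  [by [] | lia | | | | nia |].
- by move=> j R' A' [/constsP[_ R'1 _ _ [_ _ _ ->]]].
- split=> //.
  + by apply: (consts_eq HR2) => r r8; rewrite /upd !ifF //; apply/eqP; lia.
  + move=> r r20; rewrite !inE !negb_or /upd => /and3P[_ /negbTE r14 r17].
    by rewrite r14 (negbTE r17) ER2.
- move=> j u' R' A' jk F17 [HR' E EA' E14].
  have [R'0 R'1 R'2 R'3 _] := constsP HR'.
  have [dB Edj] := Htup j jk.
  have -> : 16 * (n + m) + 24 + 4 + u' = (16 * (n + m) + 24 + u').+4 by lia.
  have tB : tup j < B by have := ltn_ord (tup j); lia.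
  rewrite /= /upd /= F17 EA' // EA2 // EA' // EA2 // Edj.
  bounds lia.
  have HLA : linked A'.
    apply: (linked_eq HL) => b b7; rewrite EA' ?EA2 //; first by apply/eqP; lia.
    by rewrite !inE negb_or; apply/andP; split; apply/eqP; lia.
  have [L1 L3 L4 L5 L6] := HLA.
  apply: (@wp_explore w B n m (fun i => src i) (fun i => tgt i) G (useful G s t)
    (mem tuple_set) (tup j) out_arcP out_arc_inj 3 4 2 8 9 1);
    [by [] | by [] | by [] | by [] | by [] | by [] | | by [] | lia | lia | lia
    | by [] | | | | lia | ].
  + by rewrite /= (E 8).
  + by move=> i im; rewrite L4 //; have [_ ->] := L1 i im.
  + by move=> x; rewrite EA' // EA2 // Hu; case: (useful _ _ _ _).
  + by move=> x; rewrite EA' // E10 lt0b; rewrite inE inE.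
  move=> t3 R3' A3 ER3 E27 EA3 Em lt3.
  have [v Ev] : exists v, t3 = v.+1 by exists t3.-1; lia.
  have R30 : R3' 0 = 0 by rewrite ER3.
  have keep R'' : (forall r, r < 20 -> r != 14 -> r != 17 -> R'' r = R3' r) -> consts R''.
    move=> ER''; apply: (consts_eq HR') => r r8.
    rewrite ER'' ?ER3 ?ifF //; try apply/eqP; lia.
  have keep' r : r < 20 -> r \notin [:: 9; 14; 17] -> R3' r = R r.
    move=> r20 rn; rewrite -(E r r20 rn) ER3 //.
    by move: rn; rewrite !inE !negb_or => /and3P[/negbTE-> _ _]; rewrite (low_neq r20).
  have keepA b : b \notin [:: 9; 11] -> A3 b = A2 b.
    by move=> bn; rewrite -EA' //; move: bn; rewrite !inE negb_or => /andP[b9 b11]; apply: EA3.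
  rewrite Ev R30 E27.
  rewrite lt0b; case mj: (met_twice _ _ _ _).
    case: v Ev => [|v] Ev; first by lia.
    split; first by lia.
    split; [lia | by rewrite ER3 | split].
    + by apply: keep => r r20 /negbTE-> /negbTE->.
    + move=> r r20 rn; rewrite -(keep' r r20 rn).
      by move: rn; rewrite !inE !negb_or => /and3P[_ /negbTE-> /negbTE->].
    + by [].
    + rewrite -[X in nat_of_bool X]/(has (fun i =>
        met_twice G (useful G s t) (mem tuple_set) (tup i)) (iota 0 j.+1)).
      by rewrite iotaS has_rcons mj.
  split; [lia | by rewrite ER3 | split].
  + by apply: keep => r r20 _ /negbTE->.
  + move=> r r20 rn; rewrite -(keep' r r20 rn).
    by move: rn; rewrite !inE !negb_or => /and3P[_ _ /negbTE->].
  + by [].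
  + rewrite -[X in nat_of_bool X]/(has (fun i =>
        met_twice G (useful G s t) (mem tuple_set) (tup i)) (iota 0 j.+1)).
    by rewrite iotaS has_rcons mj -E14 /= ER3.
move=> t3 R3' A3 _ [HR3 E3 EA3 E14] lt3; apply: HQ => //.
- rewrite E14; congr nat_of_bool; rewrite /good negb_forall; apply/hasP/existsP.
    case=> i ik tw; exists (tup i); rewrite negb_imply negbK tw andbT inE.
    by apply/hasP; exists i.
  case=> u0; rewrite negb_imply negbK inE => /andP[/hasP[i ik /eqP->] tw].
  by exists i.
- move=> b; rewrite !inE !negb_or => /and3P[b9 b10 b11].
  by rewrite EA3 ?inE ?negb_or ?b9 // EA2 // EA.
- by nia.
Qed.

End Tuple.
Lemma wp_Next N x Q t0 (R : regs) (A : arrays) :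
    consts R -> R 10 = N -> 0 < N <= n ->
    (forall j, j < k -> A 16 j = digit N x j) ->
    8 * k + 3 <= t0 ->
    (forall t' R' A', consts R' ->
      (forall r, r < 20 -> r \notin [:: 15; 17] -> R' r = R r) ->
      R' 15 = (N ^ k %| x.+1) ->
      (forall b : nat, b != 16 -> A' b = A b) ->
      (forall j, j < k -> A' 16 j = digit N x.+1 j) ->
      (forall j, k <= j -> A' 16 j = A 16 j) ->
      t0 <= t' + (8 * k + 3) -> Q t' R' A') ->
  wp Next Q t0 R A.
Proof.
move=> HR R10 /andP[N0 Nn] Hd lt HQ.
have [R0 R1 R2 R3 [R4 R5 R6 R7]] := constsP HR.
have n0 : 0 < n by apply: leq_ltn_trans (ltn_ord s).
apply: wp_seq; have [u Eu] : exists u, t0 = u.+1 by exists t0.-1; lia.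
rewrite Eu; split; first by lia.
apply: (wp_for (n := k) (d := 5) (I := fun j R' A' =>
  [/\ consts R', forall r, r < 20 -> r \notin [:: 15; 17] -> R' r = R r,
    R' 15 = (N ^ j %| x.+1), forall b : nat, b != 16 -> A' b = A b &
    forall i, A' 16 i = if i < j then digit N x.+1 i else A 16 i]));
  [by [] | lia | | | | lia |].
- by move=> j R' A' [/constsP[_ R'1 _ _ [_ _ -> _]]].
- split=> //.
  + by apply: (consts_eq HR) => r r8; rewrite /upd !ifF //; apply/eqP; lia.
  + by move=> r r20; rewrite !inE negb_or /upd => /andP[/negbTE-> /negbTE->].
  + by rewrite expn0 dvd1n.
- move=> j v R' A' jk E17 [HR' E E15 EA E16].
  have [R'0 R'1 _ _ _] := constsP HR'.
  have dN : digit N x j < N by rewrite ltn_mod.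
  have ED : A' 16 j = digit N x j by rewrite E16 ltnn Hd.
  rewrite -[5 + v]/(v.+4.+1) /= /upd /= E17 ED E15 (E 10) // R10 -carryS //.
  have keep R'' : (forall r, r < 20 -> r != 15 -> r != 17 -> R'' r = R' r) -> consts R''.
    by move=> E''; apply: (consts_eq HR') => r r8; rewrite E'' //; try apply/eqP; lia.
  have b1 : nat_of_bool (N ^ j %| x.+1) <= 1 by case: (_ %| _).
  bounds lia.
  have E16' y : y = digit N x.+1 j -> forall i, upda A' 16 j y 16 i =
      if i < j.+1 then digit N x.+1 i else A 16 i.
    move=> -> i; rewrite /upda /= /upd ltnS leq_eqVlt E16.
    by case: eqVneq => [->|].
  have EA' y b : b != 16 -> upda A' 16 j y b = A b.
    by move=> b16; rewrite /upda (negbTE b16) EA.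
  case: ifP => C; bounds lia; split.
  + by apply: keep => r r20 /negbTE-> /negbTE->; rewrite !(low_neq r20).
  + move=> r r20 rn; rewrite -(E r r20 rn).
    by move: rn; rewrite !inE negb_or => /andP[/negbTE-> /negbTE->]; rewrite !(low_neq r20).
  + by rewrite C.
  + exact: EA'.
  + apply: E16'; rewrite digitS //; move: C; rewrite carryS // => /eqP->.
    by rewrite modnn R'0.
  + by apply: keep => r r20 /negbTE-> /negbTE->; rewrite !(low_neq r20).
  + move=> r r20 rn; rewrite -(E r r20 rn).
    by move: rn; rewrite !inE negb_or => /andP[/negbTE-> /negbTE->]; rewrite !(low_neq r20).
  + by rewrite C.
  + exact: EA'.
  + apply: E16'; rewrite digitS // modn_small //; move: C; rewrite carryS // => /eqP ne.
    by lia.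
- move=> t' R' A' _ [HR' E E15 EA E16] le; apply: HQ => //.
  + by move=> j jk; rewrite E16 jk.
  + by move=> j kj; rewrite E16 ltnNge kj.
  + by lia.
Qed.

(* Enumerating the tuples of candidates *)
Opaque Test Next.

(** For x < (size X)^k the digit at position k is 0, the index of s in the list of candidates, while
    the k lower digits are arbitrary. *)
Definition tuple_at (X : seq 'I_n) (x j : nat) : 'I_n := nth s X (digit (size X) x j).

Definition good_tuple (X : seq 'I_n) (x : nat) : bool :=
  good G s t (tuple_set (tuple_at X x)).

(** A round pays 70 (k + 1) (n + m) for the test and 8 k + 3 for the next tuple, which together with
    the branching stays within 80 (k + 1) (n + m). *)
Lemma wp_TryTuples (X : seq 'I_n) Q t0 (R : regs) (A : arrays) :
    uniq X -> 0 < size X ->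
    consts R -> linked A -> R 8 = 1 -> R 10 = size X -> R 13 = 0 ->
    (forall x : 'I_n, A 8 x = useful G s t x) ->
    (forall i, i < size X -> A 15 i = nth s X i) ->
    (forall i, A 16 i = 0) ->
    size X ^ k * (80 * (k.+1 * (n + m))) + 2 <= t0 ->
    (forall t' (R' : regs) (A' : arrays),
      R' 13 = has (good_tuple X) (iota 0 (size X ^ k)) -> Q t' R' A') ->
  wp TryTuples Q t0 R A.
Proof.
move=> uX X0 HR HL R8 R10 R13 Hu HX Hz lt HQ.
have [R0 R1 R2 R3 [R4 R5 R6 R7]] := constsP HR.
have n0 : 0 < n by apply: leq_ltn_trans (ltn_ord s).
have Xn : size X <= n by apply: uniq_size_ord.
set N := size X in X0 R10 HX lt HQ Xn *.
have lek : k.+1 <= k.+1 * (n + m) by nia.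
apply: wp_seq; have [u Eu] : exists u, t0 = u.+1 by exists t0.-1; lia.
rewrite Eu; split; first by lia.
pose I t' (R' : regs) (A' : arrays) := [/\ consts R', linked A',
  [/\ R' 8 = 1, R' 10 = N, forall x : 'I_n, A' 8 x = useful G s t x &
    forall i, i < N -> A' 15 i = nth s X i] &
  (R' 12 = 0 /\ R' 13 = has (good_tuple X) (iota 0 (N ^ k)) /\ 0 < t') \/
  [/\ R' 12 = 1, R' 13 = 0 & exists x, [/\ x < N ^ k,
    forall j, j <= k -> A' 16 j = digit N x j,
    ~~ has (good_tuple X) (iota 0 x) &
    (N ^ k - x) * (80 * (k.+1 * (n + m))) < t']]].
exists I.
  split=> //.
  - by apply: (consts_eq HR) => r r8; rewrite /upd !ifF //; apply/eqP; lia.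
  - right; split=> //; exists 0; split=> //; first by rewrite expn_gt0 X0.
      by move=> j _; rewrite Hz /digit div0n mod0n.
    by rewrite subn0; lia.
move=> t' R' A' [HR' HL' [R'8 R'10 Hu' HX'] C].
have [R'0 R'1 R'2 R'3 [R'4 R'5 R'6 R'7]] := constsP HR'.
case: C => [[G0 [H13 t0']]|[G1 H13 [x [xN Hd nx ltx]]]].
  by case: t' t0' => // t' _; rewrite R'0 G0; apply: HQ.
have pos : 80 * (k.+1 * (n + m)) <= (N ^ k - x) * (80 * (k.+1 * (n + m))).
  by rewrite leq_pmull // subn_gt0.
have [v Ev] : exists v, t' = v.+1 by exists t'.-1; lia.
rewrite Ev R'0 G1 /=.
have Nx : (N ^ k - x) = (N ^ k - x.+1).+1 by lia.
have dN j : digit N x j < N by rewrite ltn_mod.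
apply: (wp_Test (tup := tuple_at X x)); [by [] | by [] | by [] | by [] | | lia | ].
  move=> i ik; rewrite Hd // HX' //; split=> //; have := dN i; lia.
move=> t1 R1' A1 HR1 E1 E14 EA1 lt1.
have [R10' R11' _ _ _] := constsP HR1.
have [z Ez] : exists z, t1 = z.+3 by exists (t1 - 3); lia.
rewrite Ez R10' E14.
have HL1 : linked A1.
  by apply: (linked_eq HL') => b b7; rewrite EA1 // !inE !negb_or;
     do !(apply/andP; split); apply/eqP; lia.
have gE : good_tuple X x = good G s t (tuple_set (tuple_at X x)) by [].
have keepI t2 (R2' : regs) (A2' : arrays) : consts R2' -> R2' 8 = 1 -> R2' 10 = N ->
    (forall b : nat, b \notin [:: 9; 10; 11; 16] -> A2' b = A' b) ->
    ((R2' 12 = 0 /\ R2' 13 = has (good_tuple X) (iota 0 (N ^ k)) /\ 0 < t2) \/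
     [/\ R2' 12 = 1, R2' 13 = 0 & exists x, [/\ x < N ^ k,
       forall j, j <= k -> A2' 16 j = digit N x j,
       ~~ has (good_tuple X) (iota 0 x) &
       (N ^ k - x) * (80 * (k.+1 * (n + m))) < t2]]) -> I t2 R2' A2'.
  move=> C2 R28 R210 EA2 D; split=> //; last first.
    by split=> //; [move=> y | move=> i]; rewrite EA2 //; auto.
  apply: (linked_eq HL') => b b7; rewrite EA2 // !inE !negb_or.
  by do !(apply/andP; split); apply/eqP; lia.
have kept r : r < 20 -> r \notin [:: 9; 14; 17] -> R1' r = R' r by apply: E1.
rewrite -gE; rewrite lt0b; case: (boolP (good_tuple X x)) => gx /=.
  split; first by lia.
  split; first by lia.
  apply: keepI.
  - by apply: consts_upd => //; apply: consts_upd.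
  - by rewrite /upd /= kept.
  - by rewrite /upd /= kept.
  - by move=> b; rewrite !inE !negb_or => /and4P[b9 b10 b11 _]; rewrite EA1 // !inE !negb_or b9 b10.
  - left; split=> //; split; last by lia.
    have -> : has (good_tuple X) (iota 0 (N ^ k)) by apply/hasP; exists x; rewrite ?mem_iota.
    by [].
apply: (wp_Next (N := N) (x := x));
  [by [] | by rewrite kept | by rewrite X0 | | lia | ].
  by move=> j jk; rewrite EA1 // Hd // ltnW.
move=> t2 R2' A2' HR2 E2 E15 EA2 Hd2 Hk2 lt2.
have [R20' _ _ _ _] := constsP HR2.
have [y Ey] : exists y, t2 = y.+2 by exists (t2 - 2); lia.
have kept2 r : r < 20 -> r \notin [:: 9; 14; 15; 17] -> R2' r = R' r.
  move=> r20; rewrite !inE !negb_or => /and4P[r9 r14 r15 r17].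
  by rewrite E2 ?kept // !inE !negb_or ?r9 ?r14 ?r15 ?r17.
have kept2A b : b \notin [:: 9; 10; 11; 16] -> A2' b = A' b.
  rewrite !inE !negb_or => /and4P[b9 b10 b11 b16].
  by rewrite EA2 // EA1 // !inE !negb_or b9 b10.
have nx' : ~~ has (good_tuple X) (iota 0 x.+1) by rewrite iotaS has_rcons negb_or gx.
rewrite Ey R20' E15 lt0b; case: (boolP (N ^ k %| x.+1)) => dvx /=.
  split; first by lia.
  have Ex : x.+1 = N ^ k by apply/eqP; rewrite eqn_leq xN dvdn_leq.
  apply: keepI.
  - by apply: consts_upd.
  - by rewrite /upd /= kept2.
  - by rewrite /upd /= kept2.
  - exact: kept2A.
  - left; split=> //; split; last by lia.
    by rewrite /upd /= kept2 // H13 -Ex (negbTE nx').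
apply: keepI => //; try by rewrite kept2.
right; split; rewrite ?kept2 //; exists x.+1.
have xN' : x.+1 < N ^ k.
  by rewrite ltn_neqAle xN andbT; apply: contraNneq dvx => ->.
split=> //.
(* Entry k is not changed by [Next]: it stays 0, the digit at position k of a number below N^k. *)
- move=> j; rewrite leq_eqVlt => /predU1P[->|]; last exact: Hd2.
  by rewrite Hk2 // EA1 // Hd // /digit !divn_small.
- by move: ltx; rewrite Nx mulSn; lia.
Qed.

Definition good_candidates : bool :=
  [exists T : {set 'I_n}, [&& T \subset candidates G s t, s \in T, #|T| <= k.+1 & good G s t T]].

(** Tuples may repeat entries, in particular s, so k digits describe every set of at most k + 1
    candidates that contains s. *)
Lemma has_good_tuple (X : seq 'I_n) :
    uniq X -> X =i candidates G s t -> nth s X 0 = s ->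
  has (good_tuple X) (iota 0 (size X ^ k)) = good_candidates.
Proof.
move=> uX EX X0.
have sX : s \in X by rewrite EX !inE eqxx.
have N0 : 0 < size X by case: X sX {uX EX X0}.
apply/hasP/existsP => [[x]|[T /and4P[TX sT cT gT]]].
  rewrite mem_iota => xN gx; exists (tuple_set (tuple_at X x)).
  rewrite [X in [&& _, _, _ & X]]gx andbT.
  apply/and3P; split.
  - apply/subsetP => v; rewrite inE => /hasP[j _ /eqP->].
    by rewrite -EX mem_nth // ltn_mod.
  - rewrite inE; apply/hasP; exists k; first by rewrite mem_iota add0n ltnSn.
    by rewrite /tuple_at /digit divn_small // mod0n X0.
  - rewrite -(size_iota 0 k.+1) -(size_map (tuple_at X x)); apply: leq_trans (card_size _).
    apply: subset_leq_card; apply/subsetP => v; rewrite inE => /hasP[j jk /eqP->].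
    exact: map_f.
(* Beyond its end [l] is padded with s, the default of [nth], which belongs to T anyway. *)
pose l := enum (T :\ s).
have sl : size l <= k by rewrite -cardE; move: cT; rewrite (cardsD1 s T) sT.
have lX j : nth s l j \in X.
  have [jl|lj] := ltnP j (size l); last by rewrite nth_default.
  have := mem_nth s jl; rewrite mem_enum !inE EX => /andP[_ /(subsetP TX)].
  by [].
have [|x xN Hx] := @digits_onto (size X) k (fun j => index (nth s l j) X).
  by move=> j _; rewrite index_mem.
exists x; first by rewrite mem_iota.
rewrite /good_tuple; suff -> : tuple_set (tuple_at X x) = T by [].
have tE j : j <= k -> tuple_at X x j = nth s l j.
  rewrite leq_eqVlt => /predU1P[->|jk]; last by rewrite /tuple_at Hx // nth_index.
  by rewrite /tuple_at /digit divn_small // mod0n X0 nth_default.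
apply/setP => v; rewrite inE; apply/hasP/idP => [[j]|vT].
  rewrite mem_iota ltnS => jk /eqP->; rewrite tE //.
  have [jl|lj] := ltnP j (size l); last by rewrite nth_default.
  by have := mem_nth s jl; rewrite mem_enum !inE => /andP[].
case: (eqVneq v s) => [->|vs].
  by exists k; rewrite ?mem_iota ?add0n ?ltnSn // tE // nth_default.
have vl : v \in l by rewrite mem_enum !inE vs.
exists (index v l); last by rewrite tE ?nth_index //; apply: leq_trans sl;
  rewrite ltnW // index_mem.
by rewrite mem_iota ltnS; apply: leq_trans sl; rewrite ltnW // index_mem.
Qed.

Definition decision : bool :=
  (#|candidates G s t| <= max_candidates k) && good_candidates.

Lemma decisionP : acyclic G -> decision <-> tracking_paths G s t k.
Proof.
move=> acG; rewrite tracking_pathsE //; split=> [/andP[-> /existsP[T /and4P[*]]]|[le [T [*]]]].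
  by split=> //; exists T.
by rewrite /decision le; apply/existsP; exists T; apply/and4P.
Qed.

Lemma wp_TrackingPaths t0 (A : arrays) :
    6 * k.+2 + max_candidates k.+1 < 2 ^ w ->
    (forall i, A 0 i = nth 0 (encode es s t k) i) ->
    (forall b i, 0 < b -> A b i = 0) ->
    300 * (n + m) + 4 * k + max_candidates k ^ k * (80 * (k.+1 * (n + m))) <= t0 ->
  wp TrackingPaths (fun _ R _ => R 13 = nat_of_bool decision) t0 (fun=> 0) A.
Proof.
move=> lim H0 Hz lt.
have n0 : 0 < n by apply: leq_ltn_trans (ltn_ord s).
apply: wp_seq; apply: wp_ReadInput => //; first by lia.
move=> t1 R1 A1 HR1 HL1 Hz1 E13 lt1.
apply: wp_seq; apply: (wp_FindUseful HR1 HL1) => //; first by lia.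
move=> t2 R2 A2 HR2 E28 E213 HL2 Hu2 Hz2 lt2.
apply: wp_seq; apply: (wp_FindDegrees HR2 HL2 Hu2).
- by move=> i; apply: Hz2.
- by move=> i; apply: Hz2.
- lia.
move=> t3 R3 A3 HR3 E38 E313 EA3 Do Di lt3.
have HL3 : linked A3 by apply: (linked_eq HL2) => b b7; rewrite EA3 //; apply/eqP; lia.
have Hu3 x : A3 8 (nat_of_ord x) = useful G s t x by rewrite EA3.
apply: wp_seq; apply: (wp_FindCandidates HR3 HL3 Hu3 Do Di).
- by move=> i; rewrite EA3 // Hz2.
- lia.
move=> t4 R4 A4 X HR4 E48 E413 EA4 uX EX X0 E10 E15 lt4.
apply: wp_seq; apply: (wp_FindLimit lim HR4); first by lia.
move=> t5 R5 HR5 E5 E511 lt5.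
have cX : size X = #|candidates G s t| by rewrite -(card_uniqP uX); apply: eq_card.
have sX : 0 < size X by rewrite cX; apply/card_gt0P; exists s; rewrite !inE eqxx.
have [u Eu] : exists u, t5 = u.+1 by exists t5.-1; lia.
rewrite Eu.
rewrite -[wp _ _ _ _ _]/(if R5 11 < R5 10 then R5 13 = decision else
  wp TryTuples (fun (_ : nat) (R : regs) (_ : arrays) => R 13 = decision) u R5 A4).
rewrite E511 E5 // E10 E5 // E413 E313 E213 cX.
(* With too many candidates no tuple is tried and variable 13 keeps its initial value 0, the answer
   no. *)
case: ltnP => big; first by rewrite /decision leqNgt big.
have leX : size X ^ k <= max_candidates k ^ k.
  by case: (posnP k) => [->|k0] //; rewrite leq_exp2r // cX.
apply: (wp_TryTuples uX sX HR5).
- by apply: (linked_eq HL3) => b b7; rewrite EA4 //; apply/eqP; lia.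
- by rewrite E5 // E48 E38.
- by rewrite E5.
- by rewrite E5 // E413 E313.
- by move=> x; rewrite EA4.
- exact: E15.
- by move=> i; rewrite EA4 // EA3 // Hz2.
- have := leq_mul leX (leqnn (80 * (k.+1 * (n + m)))); lia.
- by move=> t' R' A' ->; rewrite has_good_tuple // /decision big.
Qed.

End Correctness.

(** The k-th power of this bound is the factor 2^(k^2 + 3 k). The induction compares the increment 6
    (k + 1) with 8 * 2^k, using k < 2^k. *)
Lemma max_candidates_le k : max_candidates k <= 2 ^ (k + 3).
Proof.
rewrite expnD /max_candidates; elim: k => // k IH.
by rewrite expnS; have := ltn_expl k (ltnSn 1); lia.
Qed.

Lemma size_encode n (es : seq ('I_n * 'I_n)) s t k :
  size (encode es s t k) = 5 + 2 * size es.
Proof.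
rewrite /encode size_cat; congr addn; elim: es => //= e es IH.
by rewrite IH mulnS.
Qed.

(** Measured in multiples of the time bound, the linear phases contribute 600, the term in k
    contributes 8, the tuples contribute 320 by k + 1 <= 2 (max(1, k))^2, and the constant
    contributes 30: in all 958 <= 1000. *)
Lemma time_bound_ge n m k : 0 < n ->
  2 * (300 * (n + m) + 4 * k + max_candidates k ^ k * (80 * (k.+1 * (n + m)))) + 30
    <= 1000 * time_bound n m k.
Proof.
move=> n0; rewrite /time_bound.
set p := 2 ^ (k ^ 2 + 3 * k); set q := maxn 1 k ^ 2.
have lep : max_candidates k ^ k <= p.
  have -> : p = (2 ^ (k + 3)) ^ k by rewrite -expnM mulnDl mulnn.
  by case: (posnP k) => [->|k0] //; rewrite leq_exp2r // max_candidates_le.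
have p0 : 0 < p by rewrite expn_gt0.
have lek : k < p.
  by apply: leq_trans (ltn_expl k (ltnSn 1)) _; rewrite leq_exp2l //; lia.
have leq_ : k.+1 <= 2 * q /\ 0 < q.
  rewrite /q -mulnn; case: (k) => [|j] //; rewrite (maxn_idPr (ltn0Sn j)); nia.
case: leq_ => leq_ q0.
have l1 : n + m <= p * q * (n + m) by rewrite leq_pmull // muln_gt0 p0.
have l2 : p <= p * q * (n + m) by rewrite -mulnA leq_pmulr // muln_gt0 q0; lia.
have l3 : max_candidates k ^ k * (k.+1 * (n + m)) <= 2 * (p * q * (n + m)).
  apply: leq_trans (leq_mul lep (leq_mul leq_ (leqnn (n + m)))) _; lia.
by lia.
Qed.

Theorem theorem3 :
  exists (P : program) (C c : nat),
  forall (n : nat) (G : rel 'I_n) (s t : 'I_n) (k : nat)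
         (es : seq ('I_n * 'I_n)) (w : nat),
    acyclic G ->
    perm_eq es (enum (arcs G)) ->
    (n + #|arcs G| + k + 2) ^ c <= 2 ^ w ->
    decides_within w P (encode es s t k)
      (C * time_bound n #|arcs G| k) (tracking_paths G s t k).
Proof.
exists (ram TrackingPaths 13), 1000, 8 => n G s t k es w acG esG.
have -> : #|arcs G| = size es by rewrite cardE (perm_size esG).
set z := n + _ + k + 2 => zw.
have n0 : 0 < n by apply: leq_ltn_trans (ltn_ord s).
have z3 : 3 <= z by rewrite /z; lia.
(* Origin of the exponent 8: since z >= 3, z^8 is at least 3^7 z, which leaves room for 17 blocks of
   memory, and at least 3^6 z^2, which leaves room for the quadratic limit on the candidates. *)
have z7 : 2000 * z <= 2 ^ w.
  apply: leq_trans zw; rewrite (expnD z 7 1) leq_mul2r; apply/orP; right.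
  by apply: (@leq_trans (3 ^ 7)) => //; rewrite leq_exp2r.
have z6 : 20 * (z * z) <= 2 ^ w.
  apply: leq_trans zw; rewrite (expnD z 6 2) mulnn leq_mul2r; apply/orP; right.
  by apply: (@leq_trans (3 ^ 6)) => //; rewrite leq_exp2r.
have EB : block (encode es s t k) = 2 * (n + size es + k) + 8 by [].
exists (decision G s t k); split; last exact: decisionP.
have [i le_i Hi] : answers_within w (ram TrackingPaths 13) (encode es s t k)
  (2 * (300 * (n + size es) + 4 * k +
    max_candidates k ^ k * (80 * (k.+1 * (n + size es)))) + 30) (decision G s t k).
  apply: ram_correct.
  - by rewrite size_encode EB; lia.
  - by rewrite EB /narr; lia.
  - apply: (wp_TrackingPaths esG) => //; try by rewrite EB; lia.
    have lez : k.+1 * k.+2 <= z * z by apply: leq_mul; rewrite /z; lia.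
    have zz : 3 * z <= z * z by rewrite leq_mul2r z3 orbT.
    have kz : k.+2 <= z by rewrite /z; lia.
    move: zz kz lez z6; rewrite /max_candidates; clear.
    move: (z * z) (k.+1 * k.+2) => zz kk; lia.
    by case.
exists i => //; apply: leq_trans le_i _.
exact: time_bound_ge.
Qed.
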